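(* Let $D=((X_i,Z_i,\Delta_i))_{i=1}^n$ be an i.i.d. sample of right-censored data, where $Z_i=\min\{T_i,C_i\}$, $\Delta_i=1\{C_i>T_i\}$, the triples $(X_i,T_i,C_i)$ are i.i.d. copies of $(X,T,C)$ with $X\in\mathbb R^d$ and $T,C\in\mathbb R_{\ge 0}$, $T$ and $C$ are conditionally independent given $X$, and $Z_1,\dots,Z_n$ are almost surely distinct. Assume that $C$ is independent of $X$. Let $\alpha\in[0,1]$, let $B\ge 1$ be an integer, and let $p$ be the $p$-value obtained by applying the optHSIC test (defined in the context) to $D$ with $B$ permutations and level $\alpha$. If the null hypothesis $H_0$ holds, i.e. $T$ is independent of $X$, then $p$ is uniformly distributed on $\left\{\frac{1}{B+1},\frac{2}{B+1},\dots,\frac{B+1}{B+1}\right\}$, and in particular $$P_{H_0}(p\le \alpha)\le \alpha .$$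
   Context: Standing assumption: the conditional distribution of $T$ given $X$ has a density. All internal randomness below (sampling in the transformation, the permutations, the tie-breaking) is mutually independent and independent of the data. **Multisets.** For a finite multiset $A=[a_1,\dots,a_{|A|}]$ of points of $\mathbb R^d$, $\mathrm{Uniform}(A)=\frac1{|A|}\sum_i\delta_{a_i}$ ($\delta_a$ the Dirac measure at $a$). **Optimal transport coupling.** For multisets $A=[a_1,\dots,a_{|A|}]$ and $L=[b_1,\dots,b_{|L|}]$ in $\mathbb R^d$, an optimal coupling of $U\sim\mathrm{Uniform}(A)$ and $U'\sim \mathrm{Uniform}(L)$ is a nonnegative matrix $P\in\mathbb R^{|A|\times |L|}$ minimizing $\sum_{i,j}P_{ij}\|a_i-b_j\|$ (Euclidean norm) subject to $\sum_j P_{ij}=1/|A|$ for all $i$ and $\sum_i P_{ij}=1/|L|$ for all $j$. If the minimizer is not unique, one is selected by a fixed deterministic (measurable) rule depending only on the multisets $A$ and $L$. Conditioning $P$ on $U=x$ (for $x\in A$) gives the probability vector $v$ on the elements of $L$, $v_j=\sum_{i:a_i=x}P_{ij}\big/\sum_{i:a_i=x}\frac1{|A|}$. **The transformation.** Input: a dataset $((x_i,z_i,\delta_i))_{i=1}^n$ with $x_i\in\mathbb R^d$, $z_i\ge0$ distinct, $\delta_i\in\{0,1\}$, relabelled so that $z_1<\dots<z_n$. Initialize $\mathrm{AR}=L=[x_1,\dots,x_n]$ and $\tilde D=[\,]$ (empty multiset). For $i=1,\dots,n-1$: if $\delta_i=1$, compute the optimal coupling $P$ of $U\sim\mathrm{Uniform}(\mathrm{AR})$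 and $U'\sim\mathrm{Uniform}(L)$, condition it on $U=x_i$ to get a distribution $v$ on $L$, sample $\tilde x$ from $L$ according to $v$, add $(\tilde x,z_i)$ to $\tilde D$, and remove one instance of $\tilde x$ from $L$; then (whatever $\delta_i$ is) remove one instance of $x_i$ from $\mathrm{AR}$. After this loop, for every element $\tilde x$ remaining in $L$ (with multiplicity), add $(\tilde x,z_n)$ to $\tilde D$. Output: the multiset $\tilde D$ of $n$ pairs. **HSIC.** With $k(x,x')=\|x\|+\|x'\|-\|x-x'\|$ on $\mathbb R^d$ and $l(y,y')=|y|+|y'|-|y-y'|$ on $\mathbb R_{\ge0}$, for a dataset $E=((x_i,y_i))_{i=1}^n$, $$\mathrm{HSIC}(E)=\frac1{n^2}\sum_{i,j}k(x_i,x_j)l(y_i,y_j)+\frac1{n^4}\sum_{i,j}k(x_i,x_j)\sum_{q,r}l(y_q,y_r)-\frac2{n^3}\sum_{i,j,r}k(x_i,x_j)l(y_i,y_r).$$ **optHSIC.** Apply the transformation to $D$ to get $\tilde D$, listed as $((\tilde x_i,t_i))_{i=1}^n$ with $t_1\le\dots\le t_n$. For a permutation $\pi\in S_n$ put $\pi\tilde D=((\tilde x_{\pi(i)},t_i))_{i=1}^n$. Sample $\pi_1,\dots,\pi_B$ independently and uniformly from $S_n$. Let $R$ be the rank of $\mathrm{HSIC}(\tilde D)$ in the vector $(\mathrm{HSIC}(\tilde D),\mathrm{HSIC}(\pi_1\tilde D),\dots,\mathrm{HSIC}(\pi_B\tilde D))$, ties broken uniformly at random, where $R=1$ is the rank of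 the largest element and $R=B+1$ that of the smallest. The $p$-value is $p=R/(B+1)$; $H_0$ is rejected if $p\le\alpha$. *)

(* Defs.v *)
From HB Require Import structures.
From mathcomp Require Import all_boot all_order all_algebra perm.
From mathcomp Require Import all_classical all_reals all_analysis.

Set Implicit Arguments.
Unset Strict Implicit.
Unset Printing Implicit Defensive.

Import Order.TTheory GRing.Theory Num.Theory.
Import numFieldNormedType.Exports.

Local Open Scope classical_set_scope.
Local Open Scope ring_scope.

(* Points of R^d are d.-tuple R: tuples carry the product sigma-algebra in the
   library, row vectors do not, and the library's norm on row vectors is the
   sup norm rather than the Euclidean one. *)
Notation point R d := (d.-tuple R).

Section Euclid.
Context {R : realType} {d : nat}.
Implicit Types x y : point R d.

Definition origin : point R d := [tuple 0 | _ < d].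
Definition enorm x : R := Num.sqrt (\sum_(i < d) tnth x i ^+ 2).
Definition edist x y : R := Num.sqrt (\sum_(i < d) (tnth x i - tnth y i) ^+ 2).

End Euclid.

Section Probability.
Context {dO : measure_display} {Omega : measurableType dO} {R : realType}.
Variable P : probability Omega R.

(* Mutual independence of a finite family of sub-sigma-algebras; subfamilies
   are covered because every sigma-algebra contains the whole space. *)
Definition mutually_independent (I : finType) (G : I -> set (set Omega)) :=
  forall A : I -> set Omega, (forall i, G i (A i)) ->
    P (\bigcap_i A i) = (\prod_i P (A i))%E.

Definition sigma_of {d1 : measure_display} {E : measurableType d1}
    (X : Omega -> E) : set (set Omega) :=
  preimage_set_system setT X measurable.

(* For a random element with values in a discrete space. *)
Definition sigma_of_discrete {F : Type} (X : Omega -> F) : set (set Omega) :=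
  preimage_set_system setT X setT.

Definition independent_rv {d1 d2 : measure_display}
    {E1 : measurableType d1} {E2 : measurableType d2}
    (X : Omega -> E1) (Y : Omega -> E2) :=
  forall A B, measurable A -> measurable B ->
    P (X @^-1` A `&` Y @^-1` B) = (P (X @^-1` A) * P (Y @^-1` B))%E.

(* g (X w) is a version of the conditional probability P(A | X). *)
Definition is_cond_prob {d1 : measure_display} {E : measurableType d1}
    (X : Omega -> E) (A : set Omega) (g : E -> R) :=
  [/\ measurable_fun setT g,
      forall x, 0 <= g x <= 1 &
      forall S, measurable S ->
        P (A `&` X @^-1` S) = (\int[P]_(w in X @^-1` S) (g (X w))%:E)%E].

(* P(T \in A, C \in B | X) = P(T \in A | X) P(C \in B | X) almost surely. *)
Definition cond_independent {d1 d2 d3 : measure_display}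
    {E : measurableType d1} {E2 : measurableType d2} {E3 : measurableType d3}
    (X : Omega -> E) (T : Omega -> E2) (C : Omega -> E3) :=
  forall A B, measurable A -> measurable B ->
    exists gT gC : E -> R,
      [/\ is_cond_prob X (T @^-1` A) gT,
          is_cond_prob X (C @^-1` B) gC &
          is_cond_prob X (T @^-1` A `&` C @^-1` B) (fun x => gT x * gC x)].

Definition has_cond_density {d1 : measure_display} {E : measurableType d1}
    (X : Omega -> E) (T : Omega -> R) :=
  exists f : E * R -> R,
    [/\ measurable_fun setT f,
        forall y, 0 <= f y &
        forall (S : set E) (A : set R), measurable S -> measurable A ->
          P (X @^-1` S `&` T @^-1` A) =
          (\int[P]_(w in X @^-1` S)
             \int[lebesgue_measure]_(t in A) (f (X w, t))%:E)%E].

Definition uniform_perm {m : nat} (s : Omega -> 'S_m) :=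
  forall g : 'S_m, measurable (s @^-1` [set g]) /\
    P (s @^-1` [set g]) = ((m`!)%:R^-1)%:E.

End Probability.

Section OptimalTransport.
Context {R : realType} {d : nat}.

Definition is_coupling m k (W : 'M[R]_(m, k)) :=
  [/\ forall i j, 0 <= W i j,
      forall i, \sum_j W i j = m%:R^-1 &
      forall j, \sum_i W i j = k%:R^-1].

Definition transport_cost m k (A : m.-tuple (point R d))
    (L : k.-tuple (point R d)) (W : 'M[R]_(m, k)) : R :=
  \sum_i \sum_j W i j * edist (tnth A i) (tnth L j).

Definition is_optimal_coupling m k (A : m.-tuple (point R d))
    (L : k.-tuple (point R d)) (W : 'M[R]_(m, k)) :=
  is_coupling W /\
  forall W', is_coupling W' -> transport_cost A L W <= transport_cost A L W'.

(* Mass given to the pair of points (a, b) by the coupling W, seen as a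
   measure on R^d x R^d. *)
Definition coupling_mass m k (A : m.-tuple (point R d))
    (L : k.-tuple (point R d)) (W : 'M[R]_(m, k)) (a b : point R d) : R :=
  \sum_(i < m | tnth A i == a) \sum_(j < k | tnth L j == b) W i j.

Definition selection_rule :=
  forall m k, m.-tuple (point R d) -> k.-tuple (point R d) -> 'M[R]_(m, k).

(* A deterministic measurable choice of an optimal coupling. Lists stand for
   multisets, so the second clause says that the selected coupling, as a
   measure on pairs of points, does not depend on how A and L are listed. *)
Definition optimal_selection_rule (sel : selection_rule) :=
  [/\ forall m k (A : m.-tuple (point R d)) (L : k.-tuple (point R d)),
        (0 < m)%N -> (0 < k)%N -> is_optimal_coupling A L (sel m k A L),
      forall m k (A A' : m.-tuple (point R d)) (L L' : k.-tuple (point R d)),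
        perm_eq A A' -> perm_eq L L' ->
        coupling_mass A L (sel m k A L) =2
        coupling_mass A' L' (sel m k A' L') &
      forall m k (i : 'I_m) (j : 'I_k),
        measurable_fun setT
          (fun AL : m.-tuple (point R d) * k.-tuple (point R d) =>
             sel m k AL.1 AL.2 i j)].

(* The coupling W conditioned on U = x, as weights on the entries of L. *)
Definition cond_coupling m k (A : m.-tuple (point R d)) (W : 'M[R]_(m, k))
    (x : point R d) (j : 'I_k) : R :=
  (\sum_(i < m | tnth A i == x) W i j) /
  (\sum_(i < m | tnth A i == x) m%:R^-1).

(* Inverse-transform sampling from L with weights v: for u uniform on [0, 1]
   the j-th entry is returned with probability v j. The default value is only
   reached when u is at least the total weight. *)
Definition sample_from k (L : k.-tuple (point R d)) (v : 'I_k -> R) (u : R) :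
    point R d :=
  nth origin L
    (find (fun j : 'I_k => u < \sum_(i < k | (i <= j)%N) v i) (enum 'I_k)).

End OptimalTransport.
Arguments selection_rule : clear implicits.

Section Transformation.
Context {R : realType} {d : nat}.
Variable sel : selection_rule R d.

Definition observation := (point R d * R * bool)%type.

(* D lists the observations still to be treated, in increasing order of their
   times; us supplies one uniform number per iteration (unused when the
   observation is censored). *)
Fixpoint transform_loop (D : seq observation) (us : seq R)
    (AR L : seq (point R d)) : seq (point R d * R) :=
  if D is (x, z, delta) :: D' then
    if D' is [::] then [seq (y, z) | y <- L]
    else if delta then
      let v := cond_coupling (in_tuple AR)
                 (sel (in_tuple AR) (in_tuple L)) x in
      let y := sample_from (in_tuple L) v (head 0 us) in
      (y, z) :: transform_loop D' (behead us) (rem x AR) (rem y L)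
    else transform_loop D' (behead us) (rem x AR) L
  else [::].

(* The output lists the pairs in nondecreasing order of their times. *)
Definition transform (D : seq observation) (us : seq R) :
    seq (point R d * R) :=
  let D' := sort (fun a b : observation => a.1.2 <= b.1.2) D in
  let xs := [seq o.1.1 | o <- D'] in
  transform_loop D' us xs xs.

End Transformation.

Section Test.
Context {R : realType} {d : nat}.

Definition kernel_x (x x' : point R d) : R :=
  enorm x + enorm x' - edist x x'.

Definition kernel_y (y y' : R) : R := `|y| + `|y'| - `|y - y'|.

Definition HSIC n (E : 'I_n -> point R d * R) : R :=
  (n%:R ^+ 2)^-1 *
    (\sum_i \sum_j kernel_x (E i).1 (E j).1 * kernel_y (E i).2 (E j).2) +
  (n%:R ^+ 4)^-1 *
    (\sum_i \sum_j kernel_x (E i).1 (E j).1 *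
       (\sum_q \sum_r kernel_y (E q).2 (E r).2)) -
  2 / n%:R ^+ 3 *
    (\sum_i \sum_j \sum_r kernel_x (E i).1 (E j).1 *
       kernel_y (E i).2 (E r).2).

Definition permute_data n (s : 'S_n) (E : 'I_n -> point R d * R) :
    'I_n -> point R d * R :=
  fun i => ((E (s i)).1, (E i).2).

(* Rank of h ord0 among the entries of h, rank 1 being the largest; equal
   entries are ordered by tau, a uniformly random permutation of the indices. *)
Definition rank_of_first B (h : 'I_B.+1 -> R) (tau : 'S_B.+1) : nat :=
  #|[pred j | (h ord0 < h j) ||
              ((h j == h ord0) && (tau j < tau ord0)%N)]|.+1.

Definition optHSIC_pvalue (sel : selection_rule R d) n B
    (D : n.-tuple (@observation R d)) (us : seq R)
    (pis : 'I_B -> 'S_n) (tau : 'S_B.+1) : R :=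
  let Dt : 'I_n -> point R d * R :=
    fun i => nth (origin, 0) (transform sel D us) i in
  let h : 'I_B.+1 -> R := fun j =>
    if unlift ord0 j is Some b then HSIC (permute_data (pis b) Dt)
    else HSIC Dt in
  (rank_of_first h tau)%:R / B.+1%:R.

End Test.

(* The sigma-algebras generated by the data, by each uniform variable used in
   the transformation, by each permutation, and by the tie-breaking. *)
Definition randomness_sources {dO dD : measure_display}
    {Omega : measurableType dO} {E : measurableType dD} {R : realType}
    {n B : nat} (D : Omega -> E) (U : 'I_n.-1 -> Omega -> R)
    (pis : 'I_B -> Omega -> 'S_n) (tau : Omega -> 'S_B.+1)
    (s : (unit + 'I_n.-1) + ('I_B + unit)) : set (set Omega) :=
  match s with
  | inl (inl _) => sigma_of D
  | inl (inr i) => sigma_of (U i)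
  | inr (inl b) => sigma_of_discrete (pis b)
  | inr (inr _) => sigma_of_discrete tau
  end.

(* Main.v *)
(* Under H0, conditional independence of T and C given X upgrades to
   independence of X from (T, C), hence from (Z, Delta): conditionally on the
   times and censoring indicators, all orderings of the covariates are equally
   likely. When x is uniform on AR, the point sampled from the conditional law
   of an optimal coupling has the second marginal, Uniform(L), whatever
   happened before; so the transformed covariates are a uniformly random
   ordering of x_1, ..., x_n attached to times determined by (Z, Delta).
   Composing a uniform ordering s with the permutations pi_b turns
   (s, pi_1 s, ..., pi_B s) into B+1 independent uniform orderings, so the B+1
   HSIC values are exchangeable and, ties being broken uniformly, each rank of
   the first one has probability 1/(B+1). *)

Require Import Defs.
From HB Require Import structures.
From mathcomp Require Import all_boot all_order all_algebra perm.
From mathcomp Require Import all_classical all_reals all_analysis.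
From mathcomp Require Import ring zify measurable_realfun.

Set Implicit Arguments.
Unset Strict Implicit.
Unset Printing Implicit Defensive.

Import Order.TTheory GRing.Theory Num.Theory.
Import numFieldNormedType.Exports.

Local Open Scope classical_set_scope.
Local Open Scope ring_scope.

(** * Uniform random orderings *)

(** No conditional law given the times is ever formed. Exchangeability enters only as invariance of
    the law of the data when the covariates are permuted by some [g]; averaging over all [g] reduces
    the claim to an identity between finite sums, [sum_transform_mean], valid for every fixed
    dataset. The sums are finite because, with the data fixed, the sampled indices, the permutations
    and the tie-breaking have finitely many outcomes with explicit weights. Two obstacles shape the
    argument. Covariates may coincide, so a random ordering is a mean over lists counted with
    multiplicity. And lists stand for multisets: the selected coupling matrix may change when its
    arguments are relisted, only its mass on pairs of points being fixed. Single weights can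
    therefore not be compared across listings; comparisons are made between sums against functions
    of the sampled point, and the final rank count has to be shown insensitive to relisting. *)

Lemma rem_perm_eq (T : eqType) (x : T) (s s' : seq T) :
  perm_eq s s' -> perm_eq (rem x s) (rem x s').
Proof.
move=> ss'; have [xs|xs] := boolP (x \in s); last first.
  by rewrite !rem_id // -(perm_mem ss').
have xs' : x \in s' by rewrite -(perm_mem ss').
by rewrite -(perm_cons x) -(permPl (perm_to_rem xs)) -(permPr (perm_to_rem xs')).
Qed.

Section OrderingMean.
Context {R : numFieldType} {T : eqType}.
Implicit Types (s t : seq T) (psi : seq T -> R).

(** The mean of [psi] over a uniformly random ordering of the multiset [s], drawn element by element
    without replacement, equal entries counting with multiplicity. The recursion mirrors the loop,
    which removes points from its lists one at a time. The fuel [n] stands for [size s], as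
    recursion through [rem] is not structural. *)
Fixpoint ordering_mean_rec n s psi : R :=
  if n is n'.+1 then
    n%:R^-1 * \sum_(y <- s) ordering_mean_rec n' (rem y s) (fun t => psi (y :: t))
  else psi [::].

Definition ordering_mean s psi := ordering_mean_rec (size s) s psi.

Lemma ordering_mean_rec_perm n s s' psi : perm_eq s s' ->
  ordering_mean_rec n s psi = ordering_mean_rec n s' psi.
Proof.
elim: n s s' psi => //= n IHn s s' psi ss'.
rewrite (perm_big _ ss') /=; congr (_ * _).
by apply: eq_bigr => y _; apply: IHn; exact: rem_perm_eq.
Qed.

Lemma ordering_mean_perm s s' psi : perm_eq s s' ->
  ordering_mean s psi = ordering_mean s' psi.
Proof.
by move=> ss'; rewrite /ordering_mean (perm_size ss') (ordering_mean_rec_perm _ _ ss').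
Qed.

Lemma ordering_mean0 psi : ordering_mean [::] psi = psi [::].
Proof. by []. Qed.

Lemma ordering_meanS s psi : (0 < size s)%N -> ordering_mean s psi =
  (size s)%:R^-1 *
  \sum_(y <- s) ordering_mean (rem y s) (fun t => psi (y :: t)).
Proof.
rewrite /ordering_mean; case: s => // x s _ /=; congr (_ * _).
rewrite big_seq [RHS]big_seq; apply: eq_bigr => y /size_rem /= ys.
by rewrite -[if _ == _ then _ else _]/(rem y (x :: s)) ys.
Qed.

(** Only orderings of [s] are ever fed to [psi]. *)
Lemma eq_ordering_mean s psi psi' :
  (forall t, perm_eq t s -> psi t = psi' t) ->
  ordering_mean s psi = ordering_mean s psi'.
Proof.
have [n] := ubnP (size s); elim: n s psi psi' => // n IHn s psi psi' sn e.
have [/size0nil s0|s0] := posnP (size s).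
  by rewrite s0 !ordering_mean0 e // s0.
rewrite !ordering_meanS //; congr (_ * _).
rewrite big_seq [RHS]big_seq; apply: eq_bigr => y ys; apply: IHn.
  by rewrite size_rem // prednK.
move=> t ht; apply: e; rewrite perm_sym (permPl (perm_to_rem ys)).
by rewrite perm_cons perm_sym.
Qed.

Lemma ordering_mean_sum I (r : seq I) (F : I -> seq T -> R) s :
  ordering_mean s (fun t => \sum_(i <- r) F i t) =
  \sum_(i <- r) ordering_mean s (F i).
Proof.
rewrite /ordering_mean; move: (size s) => n; elim: n s F => [//|n IHn] s F /=.
rewrite -mulr_sumr; congr (_ * _); rewrite exchange_big; apply: eq_bigr => y _.
by rewrite (IHn _ (fun i t => F i (y :: t))).
Qed.

Lemma ordering_mean_mull c psi s :
  ordering_mean s (fun t => c * psi t) = c * ordering_mean s psi.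
Proof.
rewrite /ordering_mean; move: (size s) => n; elim: n s psi => [//|n IHn] s psi /=.
rewrite [RHS]mulrCA; congr (_ * _); rewrite mulr_sumr; apply: eq_bigr => y _.
by rewrite IHn.
Qed.

Lemma ordering_mean_cst c s : ordering_mean s (fun=> c) = c.
Proof.
have [n] := ubnP (size s); elim: n s => // n IHn s sn.
have [/size0nil ->//|s0] := posnP (size s).
rewrite ordering_meanS // big_seq (eq_bigr (fun=> c)); last first.
  by move=> y ys; apply: IHn; rewrite size_rem // prednK.
rewrite -big_seq big_const_seq count_predT iter_addr_0 -[c *+ _]mulr_natl mulrA.
by rewrite mulVf ?mul1r // pnatr_eq0 -lt0n.
Qed.

Lemma ordering_mean_const c psi s : (forall t, perm_eq t s -> psi t = c) ->
  ordering_mean s psi = c.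
Proof. by move=> e; rewrite (eq_ordering_mean e) ordering_mean_cst. Qed.

(** Links the mean over the symmetric group to the recursive one. Split on the image [j] of the
    first index: the permutations with [g ord0 = j] are lifts of permutations of one point fewer,
    and they list, after [x j], what is left once one copy of [x j] is removed. *)
Lemma sum_perm_ordering_mean n (x : 'I_n -> T) psi :
  \sum_(g : 'S_n) psi [seq x (g i) | i <- enum 'I_n] =
  n`!%:R * ordering_mean [seq x i | i <- enum 'I_n] psi.
Proof.
elim: n x psi => [|n IHn] x psi.
  rewrite (eq_bigr (fun=> psi [::])) => [|g _]; last first.
    by rewrite (size0nil (size_enum_ord 0)).
  by rewrite sumr_const card_Sn (size0nil (size_enum_ord 0)) mul1r.
have sz : size [seq x i | i <- enum 'I_n.+1] = n.+1 by rewrite size_map size_enum_ord.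
rewrite ordering_meanS ?sz // [RHS]mulrA factS mulnC natrM mulfK ?pnatr_eq0 //.
rewrite big_map big_enum /= mulr_sumr.
rewrite (partition_big (fun g : 'S_n.+1 => g ord0) predT) //=.
apply: eq_bigr => j _.
transitivity (\sum_(g : 'S_n) psi (x j :: [seq x (lift j (g i)) | i <- enum 'I_n])).
  rewrite (reindex (lift_perm ord0 j)); last first.
    (* The inverse of [lift_perm]: delete the index [i] and its image, then renumber. The default
       [k] is never reached, since [g] is injective. *)
    pose ulsf i (g : 'S_n.+1) k := odflt k (unlift (g i) (g (lift i k))).
    have ulsfK i (g : 'S_n.+1) k: lift (g i) (ulsf i g k) = g (lift i k).
      rewrite /ulsf; have:= neq_lift i k.
      by rewrite -(can_eq (permK g)) => /unlift_some[] ? ? ->.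
    have inj_ulsf : injective (ulsf ord0 _).
      move=> g; apply: can_inj (ulsf (g ord0) g^-1%g) _ => k'.
      by rewrite {1}/ulsf ulsfK !permK liftK.
    exists (fun g => perm (inj_ulsf g)) => [g _ | g].
      by apply/permP=> k'; rewrite permE /ulsf lift_perm_lift lift_perm_id liftK.
    move/(g _ =P _) => gi; apply/permP => k.
    case: (unliftP ord0 k) => [k'|] ->; rewrite ?lift_perm_id //.
    by rewrite lift_perm_lift -gi permE ulsfK.
  apply: eq_big => [g|g _]; first by rewrite lift_perm_id eqxx.
  congr psi; rewrite enum_ordSl /= lift_perm_id; congr cons.
  by rewrite -map_comp; apply: eq_map => i /=; rewrite lift_perm_lift.
rewrite (IHn (fun i => x (lift j i)) (fun t => psi (x j :: t))).
congr (_ * _); apply: ordering_mean_perm.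
rewrite -(perm_cons (x j)); apply: (@perm_trans _ [seq x i | i <- enum 'I_n.+1]).
  rewrite (_ : _ :: _ = [seq x i | i <- j :: [seq lift j i | i <- enum 'I_n]]).
    apply: perm_map; apply: uniq_perm.
    - rewrite /= map_inj_uniq ?enum_uniq ?andbT; last exact: lift_inj.
      by apply/mapP => -[i _ /eqP]; rewrite (negbTE (neq_lift _ _)).
    - exact: enum_uniq.
    - move=> i; rewrite mem_enum in_cons; case: (unliftP j i) => [i'|] ->.
        by rewrite map_f ?mem_enum // orbT.
      by rewrite eqxx.
  by rewrite /= -map_comp.
by rewrite perm_to_rem // map_f // mem_enum.
Qed.

End OrderingMean.

(** * The mean of the transformation *)

Lemma sum_tnth_undup (V : nmodType) (T : eqType) k (L : k.-tuple T) (F : 'I_k -> T -> V) :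
  \sum_(j < k) F j (tnth L j) =
  \sum_(y <- undup L) \sum_(j < k | tnth L j == y) F j y.
Proof.
rewrite (exchange_big_dep predT) //=; apply: eq_bigr => j _.
rewrite big_mkcond (bigD1_seq (tnth L j)) ?undup_uniq ?mem_undup ?mem_tnth //=.
by rewrite eqxx big1 ?addr0 // => y /negbTE; rewrite eq_sym => ->.
Qed.

Section LoopMean.
Context {R : realType} {d : nat}.
Variable sel : selection_rule R d.
Notation pt := (d.-tuple R).
Implicit Types (D : seq (@observation R d)) (AR L : seq pt).
Implicit Types (phi : seq (pt * R) -> R) (zs : seq (R * bool)).

Definition loop_weight AR L (x : pt) : 'I_(size L) -> R :=
  cond_coupling (in_tuple AR) (sel (in_tuple AR) (in_tuple L)) x.

(* The mean of phi over the output of transform_loop for independent uniform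
   samples us, as a finite sum over the sampled indices. *)
Fixpoint loop_mean D AR L phi : R :=
  if D is (x, z, delta) :: D' then
    if D' is [::] then phi [seq (y, z) | y <- L]
    else if delta then
      \sum_(j < size L) loop_weight AR x j *
        loop_mean D' (rem x AR) (rem (tnth (in_tuple L) j) L)
          (fun s => phi ((tnth (in_tuple L) j, z) :: s))
    else loop_mean D' (rem x AR) L phi
  else phi [::].

Definition attach (xs : seq pt) zs : seq (@observation R d) :=
  [seq (p.1, p.2.1, p.2.2) | p <- zip xs zs].

(** The times in the order the loop emits them when [l] points are left in [L]; the last time
    absorbs all points not yet used. No covariate occurs, which is what separates times from
    covariates in the output. *)
Fixpoint output_times zs (l : nat) : seq R :=
  if zs is (z, delta) :: zs' then
    if zs' is [::] then nseq l z
    else if delta then z :: output_times zs' l.-1 else output_times zs' l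
  else [::].

(** Stated on lists rather than tuples, so that relisted arguments can be compared without
    transporting along equalities of sizes. *)
Definition pair_mass AR L : pt -> pt -> R :=
  coupling_mass (in_tuple AR) (in_tuple L) (sel (in_tuple AR) (in_tuple L)).

Lemma pair_mass_tuple m k (A : m.-tuple pt) (L : k.-tuple pt) :
  pair_mass A L = coupling_mass A L (sel A L).
Proof.
case: A => A /[dup] /eqP hA; case: L => L /[dup] /eqP hL /=; subst m k => pL pA.
by rewrite (eq_irrelevance pL (eqxx _)) (eq_irrelevance pA (eqxx _)).
Qed.

Hypothesis sel_rule : optimal_selection_rule sel.

Lemma pair_mass_perm AR AR' L L' : perm_eq AR AR' -> perm_eq L L' ->
  pair_mass AR L =2 pair_mass AR' L'.
Proof.
move=> pA pL x y; have [_ inv _] := sel_rule.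
have sA : size AR' == size AR by rewrite (perm_size pA).
have sL : size L' == size L by rewrite (perm_size pL).
rewrite -[AR']/(tval (Tuple sA)) -[L']/(tval (Tuple sL)).
rewrite -[AR in LHS]/(tval (in_tuple AR)) -[L in LHS]/(tval (in_tuple L)).
by rewrite !pair_mass_tuple; apply: inv.
Qed.

(** Grouping the indices by the point they hold leaves only the coupling mass of pairs of points,
    which is all that the selection rule keeps fixed under relisting. The denominator of the
    conditioning is the frequency of [x] in [AR]. *)
Lemma sum_loop_weight AR L x (F : pt -> R) :
  \sum_(j < size L) loop_weight AR x j * F (tnth (in_tuple L) j) =
  ((count_mem x AR)%:R / (size AR)%:R)^-1 *
    \sum_(y <- undup L) pair_mass AR L x y * F y.
Proof.
have den : \sum_(i < size AR | tnth (in_tuple AR) i == x) (size AR)%:R^-1 =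
    (count_mem x AR)%:R / (size AR)%:R :> R.
  rewrite sumr_const mulr_natl; congr (_ *+ _).
  rewrite -sum1_card -sum1_count [RHS](big_nth x) big_mkord.
  by apply: eq_bigl => i; rewrite /= unfold_in (tnth_nth x).
rewrite [LHS](sum_tnth_undup (in_tuple L) (fun j y => loop_weight AR x j * F y)).
rewrite mulr_sumr.
apply: eq_bigr => y _; rewrite -mulr_suml mulrA; congr (_ * _).
rewrite /pair_mass /coupling_mass /loop_weight /cond_coupling den -mulr_suml.
by rewrite mulrC exchange_big.
Qed.

(** The column marginal of the coupling, collected over the positions of [L] that hold [y]. *)
Lemma sum_pair_mass AR L y : (0 < size AR)%N -> (0 < size L)%N ->
  \sum_(x <- undup AR) pair_mass AR L x y = (count_mem y L)%:R / (size L)%:R.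
Proof.
move=> AR0 L0; have [opt _ _] := sel_rule.
have [[_ _ colW] _] := opt _ _ (in_tuple AR) (in_tuple L) AR0 L0.
rewrite /pair_mass /coupling_mass.
rewrite -(sum_tnth_undup (in_tuple AR) (fun i _ => \sum_(j < size L | tnth (in_tuple L) j == y)
   sel (in_tuple AR) (in_tuple L) i j)).
rewrite exchange_big (eq_bigr (fun=> (size L)%:R^-1)) => [|j _]; last exact: colW.
rewrite sumr_const mulr_natl; congr (_ *+ _).
rewrite -sum1_card -sum1_count [RHS](big_nth y) big_mkord.
by apply: eq_bigl => i; rewrite /= unfold_in (tnth_nth y).
Qed.

(** Averaging over [AR] weighs each distinct [x] by its frequency, which cancels the denominator of
    the conditioning; the column marginal remains. *)
Lemma sum_loop_weight_mean AR L (F : pt -> R) :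
  (0 < size AR)%N -> (0 < size L)%N ->
  (size AR)%:R^-1 *
    \sum_(x <- AR) \sum_(j < size L) loop_weight AR x j * F (tnth (in_tuple L) j) =
  (size L)%:R^-1 * \sum_(y <- L) F y.
Proof.
move=> AR0 L0.
rewrite -[\sum_(x <- AR) _]big_undup_iterop_count mulr_sumr.
transitivity (\sum_(x <- undup AR) \sum_(y <- undup L) pair_mass AR L x y * F y).
  rewrite big_seq [RHS]big_seq; apply: eq_bigr => x; rewrite mem_undup => xAR.
  have c0 : (count_mem x AR)%:R != 0 :> R.
    by rewrite pnatr_eq0 -lt0n -has_count has_pred1.
  have s0 : (size AR)%:R != 0 :> R by rewrite pnatr_eq0 -lt0n.
  rewrite sum_loop_weight -[iterop _ _ _ _]/(_ *+ count_mem x AR).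
  by rewrite -[X in _ * X]mulr_natl !mulrA -[RHS]mul1r; congr (_ * _); field; rewrite c0 s0.
rewrite exchange_big /= -[X in _ = _ * X]big_undup_iterop_count mulr_sumr.
apply: eq_bigr => y _; rewrite -mulr_suml sum_pair_mass //.
by rewrite -[iterop _ _ _ _]/(_ *+ count_mem y L) -[X in _ = _ * X]mulr_natl mulrCA mulrA.
Qed.

End LoopMean.

Section LoopMeanUniform.
Context {R : realType} {d : nat}.
Variable sel : selection_rule R d.
Hypothesis sel_rule : optimal_selection_rule sel.
Notation pt := (d.-tuple R).
Implicit Types (AR L : seq pt) (phi : seq (pt * R) -> R) (zs : seq (R * bool)).

(** In the averaged loop the points behind [x] come in a random order, which the law of the sampled
    point must not see. *)
Lemma loop_weight_perm_mean AR AR' L x (F : pt -> R) : perm_eq AR AR' ->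
  \sum_(j < size L) loop_weight sel AR x j * F (tnth (in_tuple L) j) =
  \sum_(j < size L) loop_weight sel AR' x j * F (tnth (in_tuple L) j).
Proof.
move=> pAR; rewrite !sum_loop_weight.
rewrite (seq.permP pAR) (perm_size pAR); congr (_ * _); apply: eq_bigr => y _.
by congr (_ * _); apply: pair_mass_perm.
Qed.

(* The selected coupling has uniform marginals, so averaging the conditional
   law of the sampled point over a uniformly random U = x gives Uniform(L). *)
Lemma ordering_mean_loop zs AR L phi :
  (0 < size zs)%N -> size AR = size zs -> (size zs <= size L)%N ->
  (forall s s', size s = size L -> perm_eq s s' -> phi s = phi s') ->
  ordering_mean AR (fun xs => loop_mean sel (attach xs zs) xs L phi) =
  ordering_mean L (fun ys => phi (zip ys (output_times zs (size L)))).
Proof.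
elim: zs AR L phi => // -[z delta] zs IHzs AR L phi _ /= sAR sL phi_perm.
have AR0 : (0 < size AR)%N by rewrite sAR.
have L0 : (0 < size L)%N by apply: leq_trans sL.
have [zs0|zs0] := posnP (size zs).
  rewrite (size0nil zs0) /= in sAR *.
  rewrite (@ordering_mean_const _ _ (phi [seq (y, z) | y <- L])); last first.
    by move=> [|x [|x' xs]] /perm_size; rewrite sAR.
  rewrite (@ordering_mean_const _ _ (phi [seq (y, z) | y <- L])) // => ys ysL.
  rewrite -(perm_size ysL).
  rewrite (_ : zip _ _ = [seq (y, z) | y <- ys]); last by elim: (ys) => //= y s ->.
  by apply: phi_perm; rewrite ?size_map ?(perm_size ysL) ?perm_map.
have szr x : x \in AR -> size (rem x AR) = size zs.
  by move=> xAR; rewrite size_rem // sAR.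
have szL y : y \in L -> size (rem y L) = (size L).-1 by move=> yL; rewrite size_rem.
(* The weights are rewritten with the fixed list [AR] in place of [x :: xs], so that the mean over
   the orderings [xs] can be moved inside the sum over sampled indices. *)
have stepE x xs : x \in AR -> perm_eq xs (rem x AR) ->
  loop_mean sel (attach (x :: xs) ((z, delta) :: zs)) (x :: xs) L phi =
  if delta then
    \sum_(j < size L) loop_weight sel AR x j *
        loop_mean sel (attach xs zs) xs (rem (tnth (in_tuple L) j) L)
          (fun s => phi ((tnth (in_tuple L) j, z) :: s))
  else loop_mean sel (attach xs zs) xs L phi.
  move=> xAR pxs; rewrite [LHS]/=.
  case E : (attach xs zs) => [|o D'].
    have := congr1 size E; rewrite size_map size_zip (perm_size pxs) szr //.
    by rewrite minnn => zs0'; rewrite zs0' in zs0.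
  rewrite -/(attach xs zs) E eqxx; case: delta => //.
  apply: (@loop_weight_perm_mean _ _ _ _ (fun y => loop_mean sel (o :: D') xs
    (rem y L) (fun s => phi ((y, z) :: s)))).
  by rewrite perm_sym (permPl (perm_to_rem xAR)) perm_cons perm_sym.
rewrite ordering_meanS //.
under eq_big_seq => x xAR.
  rewrite (@eq_ordering_mean _ _ _ _ _ (fun xs => stepE x xs xAR)).
  over.
(* In the censored case [L] is untouched and the induction hypothesis gives a value free of [AR]:
   the mean over [x] is that of a constant. *)
case: delta {stepE} => /=; last first.
  under eq_big_seq => x xAR.
    rewrite IHzs ?szr // ?(ltnW sL) //; over.
  rewrite big_const_seq count_predT iter_addr_0 -[X in _ * X]mulr_natl mulrA.
  rewrite mulVf ?mul1r ?pnatr_eq0 -?lt0n //.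
  by case: (zs) zs0.
transitivity ((size AR)%:R^-1 * \sum_(x <- AR) \sum_(j < size L)
    loop_weight sel AR x j * ordering_mean (rem (tnth (in_tuple L) j) L)
      (fun ys => phi ((tnth (in_tuple L) j, z) :: zip ys (output_times zs (size L).-1)))).
  congr (_ * _); apply: eq_big_seq => x xAR; rewrite ordering_mean_sum.
  apply: eq_bigr => j _; rewrite ordering_mean_mull; congr (_ * _).
  have jL : tnth (in_tuple L) j \in L by exact: mem_tnth.
  rewrite IHzs ?szr // ?szL //; first by rewrite -ltnS prednK.
  move=> s s' sz ss'; apply: phi_perm; last by rewrite perm_cons.
  by rewrite /= sz ?szL // prednK.
(* The draw of [x] from [AR] followed by the coupling is replaced by one uniform draw of [y] from
   [L], the first draw of an ordering of [L]. *)
rewrite (sum_loop_weight_mean sel_rule (fun y => ordering_mean (rem y L)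
      (fun ys => phi ((y, z) :: zip ys (output_times zs (size L).-1))))) //.
by rewrite [RHS]ordering_meanS //; case: (zs) zs0.
Qed.

(** The transformation starts with [L] listed like [AR], whereas averaging over the orderings of
    [AR] requires [L] to stay fixed; this lemma allows [L] to be relisted once and for all. *)
Lemma loop_mean_perm D AR L L' phi : (size D <= size L)%N ->
  (forall s s', size s = size L -> perm_eq s s' -> phi s = phi s') ->
  perm_eq L L' -> loop_mean sel D AR L phi = loop_mean sel D AR L' phi.
Proof.
elim: D AR L L' phi => [|[[x z] delta] D IHD] AR L L' phi /= sL phi_perm LL'.
  by [].
case: D IHD sL => [|o D] IHD sL.
  by apply: phi_perm; rewrite ?size_map ?perm_map.
case: delta; last by apply: IHD => //; exact: ltnW.
rewrite (@sum_loop_weight _ _ _ _ _ _ (fun y => loop_mean sel (o :: D) (rem x AR)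
  (rem y L) (fun s => phi ((y, z) :: s)))).
rewrite (@sum_loop_weight _ _ _ _ _ _ (fun y => loop_mean sel (o :: D) (rem x AR)
  (rem y L') (fun s => phi ((y, z) :: s)))).
congr (_ * _); rewrite (perm_big (undup L')) /=; last first.
  by apply: perm_undup; exact: perm_mem.
apply: eq_big_seq => y; rewrite mem_undup -(perm_mem LL') => yL.
rewrite (pair_mass_perm sel_rule (perm_refl AR) LL'); congr (_ * _).
have L0 : (0 < size L)%N by apply: leq_trans sL.
apply: IHD; rewrite ?size_rem //; last exact: rem_perm_eq.
  by rewrite -ltnS prednK.
move=> s s' sz ss'; apply: phi_perm; last by rewrite perm_cons.
by rewrite /= sz prednK.
Qed.

End LoopMeanUniform.

(** * Ranks of exchangeable values *)

Section RankUniform.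
Context {R : realType}.

Definition outranks n (h : 'I_n -> R) (tau : 'S_n) (i j : 'I_n) : bool :=
  (h j < h i) || ((h i == h j) && (tau i < tau j)%N).

(** At [ord0] this is convertible to [rank_of_first]; other positions are needed to exchange them
    with the first. *)
Definition rank_at n (h : 'I_n -> R) (tau : 'S_n) (j : 'I_n) : nat :=
  #|[pred i | outranks h tau i j]|.+1.

Lemma outranks_irr n (h : 'I_n -> R) tau i : outranks h tau i i = false.
Proof. by rewrite /outranks ltxx ltnn andbF. Qed.

Lemma outranks_trans n (h : 'I_n -> R) tau : transitive (outranks h tau).
Proof.
move=> j i k /orP[ji|/andP[/eqP ij tij]] /orP[kj|/andP[/eqP jk tjk]]; apply/orP.
- by left; apply: lt_trans ji.
- by left; rewrite -jk.
- by left; rewrite ij.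
- by right; rewrite ij jk eqxx (ltn_trans tij).
Qed.

Lemma outranks_total n (h : 'I_n -> R) tau i j :
  i != j -> outranks h tau i j || outranks h tau j i.
Proof.
move=> ij; rewrite /outranks; have [_|_|_] //= := ltgtP (h i) (h j).
have [//|//|/val_inj/perm_inj e] := ltngtP (tau i) (tau j).
by rewrite e eqxx in ij.
Qed.

Lemma rank_at_inj n (h : 'I_n -> R) tau : injective (rank_at h tau).
Proof.
have lt i j : outranks h tau i j -> (rank_at h tau i < rank_at h tau j)%N.
  move=> ij; rewrite ltnS; apply: proper_card; apply/properP; split.
    by apply/fintype.subsetP => k; rewrite !inE => /outranks_trans; apply.
  by exists i; rewrite !inE ?outranks_irr.
move=> i j e; apply/eqP; apply/negPn/negP => /(outranks_total h tau).
by case/orP => /lt; rewrite e ltnn.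
Qed.

Lemma rank_at_le n (h : 'I_n -> R) tau j : (rank_at h tau j <= n)%N.
Proof.
rewrite /rank_at -[X in (_ <= X)%N]card_ord; apply: proper_card.
by apply/properP; split; [exact/fintype.subsetP|exists j; rewrite ?inE ?outranks_irr].
Qed.

(** [outranks] is a strict total order thanks to the tie-breaking, so the ranks are distinct numbers
    between 1 and [n] and hence take every such value once. *)
Lemma sum_rank_at n (h : 'I_n -> R) tau k : (1 <= k <= n)%N ->
  (\sum_j (rank_at h tau j == k) = 1)%N.
Proof.
case: n => [|n] in h tau *; first by case: k.
case/andP => k1 kn.
pose r j : 'I_n.+1 := inord (rank_at h tau j).-1.
have rE j : (r j).+1 = rank_at h tau j by rewrite inordK // rank_at_le.
have r_inj : injective r.
  by move=> i j e; apply: (@rank_at_inj _ h tau); rewrite -!rE e.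
have [g gr rg] := injF_bij r_inj.
pose j0 := g (inord k.-1).
have j0E : rank_at h tau j0 = k.
  by rewrite -rE rg inordK prednK.
rewrite (bigD1 j0) //= j0E eqxx big1 // => j jj0; apply/eqP.
by rewrite eqb0; apply: contra jj0 => /eqP e; apply/eqP/(@rank_at_inj _ h tau); rewrite e.
Qed.

Lemma rank_at_perm n (h : 'I_n -> R) (tau s : 'S_n) j :
  rank_at (h \o s) (s * tau)%g j = rank_at h tau (s j).
Proof.
rewrite /rank_at; congr _.+1.
rewrite -!sum1_card [RHS](reindex_inj (@perm_inj _ s)).
by apply: eq_bigl => i; rewrite !inE /outranks /= !permM.
Qed.

(* All B.+1 positions are exchangeable, and exactly one of them has rank k. *)
Lemma sum_rank_of_first (F : finType) (h : F -> R) B k : (1 <= k <= B.+1)%N ->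
  ((\sum_(q : {ffun 'I_B.+1 -> F}) \sum_(tau : 'S_B.+1)
     (rank_of_first (h \o q) tau == k)) * B.+1 = #|F| ^ B.+1 * (B.+1)`!)%N.
Proof.
move=> kB; pose N j := (\sum_(q : {ffun 'I_B.+1 -> F}) \sum_(tau : 'S_B.+1)
  (rank_at (h \o q) tau j == k))%N.
have N0 j : N j = N ord0.
  (* Swapping positions [ord0] and [j] in both [q] and [tau] permutes the summation indices and
     carries the rank at one position to the other. *)
  rewrite /N; pose t := tperm ord0 j.
  have tK : involutive (fun q : {ffun 'I_B.+1 -> F} => [ffun i => q (t i)]).
    by move=> q; apply/ffunP => i; rewrite !ffunE tpermK.
  rewrite [RHS](reindex_inj (inv_inj tK)); apply: eq_bigr => q _.
  rewrite [RHS](reindex_inj (mulgI t)); apply: eq_bigr => tau _.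
  rewrite -[j in LHS](tpermL ord0 j) -rank_at_perm; congr (_ == _).
  by congr rank_at; apply/funext => i /=; rewrite ffunE.
transitivity (\sum_(j < B.+1) N j)%N.
  rewrite [RHS](eq_bigr (fun=> N ord0)) => [|j _]; last exact: N0.
  by rewrite sum_nat_const card_ord mulnC.
rewrite /N exchange_big /=; under eq_bigr do rewrite exchange_big /=.
under eq_bigr do under eq_bigr do rewrite sum_rank_at //.
by rewrite sum_nat_const sum_nat_const card_Sn muln1 card_ffun card_ord.
Qed.

End RankUniform.

(** * Insensitivity of the rank count to the listing of the data *)

Section DataPermutation.
Context {R : realType} {d : nat}.
Notation pt := (d.-tuple R).

Lemma HSIC_perm n (s : 'S_n) (E : 'I_n -> pt * R) :
  HSIC (fun i => E (s i)) = HSIC E.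
Proof.
have re (V : nmodType) (F : 'I_n -> V) : \sum_i F (s i) = \sum_i F i.
  by rewrite [RHS](reindex_inj (@perm_inj _ s)).
have re2 (V : nmodType) (F : 'I_n -> 'I_n -> V) :
    \sum_i \sum_j F (s i) (s j) = \sum_i \sum_j F i j.
  by rewrite -[RHS]re; apply: eq_bigr => i _; rewrite re.
rewrite /HSIC; congr (_ * _ + _ * _ - _ * _).
- exact: (re2 _ (fun i j => kernel_x (E i).1 (E j).1 * kernel_y (E i).2 (E j).2)).
- rewrite (re2 _ (fun i j => kernel_y (E i).2 (E j).2)).
  exact: (re2 _ (fun i j => kernel_x (E i).1 (E j).1 * _)).
- rewrite -[RHS]re2; apply: eq_bigr => i _; apply: eq_bigr => j _.
  exact: (re _ (fun r => kernel_x (E (s i)).1 (E (s j)).1 * kernel_y (E (s i)).2 (E r).2)).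
Qed.

Definition dataset n (s : seq (pt * R)) : 'I_n -> pt * R :=
  fun i => nth (origin, 0) s i.

Definition HSIC_values n B (s : seq (pt * R)) (pi : 'I_B -> 'S_n) (j : 'I_B.+1) : R :=
  if unlift ord0 j is Some b then HSIC (permute_data (pi b) (dataset s))
  else HSIC (@dataset n s).

Definition rank_count n B k (s : seq (pt * R)) : nat :=
  \sum_(pi : {ffun 'I_B -> 'S_n}) \sum_(tau : 'S_B.+1)
    (rank_of_first (HSIC_values s pi) tau == k).

(** Relisting the data by [p] turns the effect of a permutation into that of its conjugate by [p].
    The individual permuted HSIC values do change, but conjugation is a bijection on families of
    permutations, so the count over all of them does not. *)
Lemma rank_count_perm n B k s s' : size s = n -> perm_eq s s' ->
  rank_count n B k s = rank_count n B k s'.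
Proof.
move=> sn; rewrite perm_sym => ss'.
have sn' : size s' == n by rewrite (perm_size ss') sn.
have {}sn : size s == n by rewrite sn.
have [p pE] := tuple_permP (ss' : perm_eq (Tuple sn') (Tuple sn)).
have dE i : dataset s' i = @dataset n s (p i).
  rewrite /dataset -[s']/(tval (Tuple sn')) pE -tnth_nth tnth_mktuple.
  by rewrite (tnth_nth (origin, 0)).
pose c (pi : {ffun 'I_B -> 'S_n}) := [ffun b => (pi b ^ p)%g].
have c_inj : injective c.
  by move=> f g /ffunP fg; apply/ffunP => b; have := fg b; rewrite !ffunE => /conjg_inj.
rewrite /rank_count [LHS](reindex_inj c_inj); apply: eq_bigr => pi _.
apply: eq_bigr => tau _; congr (rank_of_first _ tau == k).
apply/funext => j; rewrite /HSIC_values; case: unlift => [b|]; last first.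
  by rewrite -[LHS](HSIC_perm p); congr HSIC; apply/funext => i; rewrite dE.
rewrite -[LHS](HSIC_perm p); congr HSIC; apply/funext => i.
by rewrite /permute_data !dE ffunE conjgE !permM permK.
Qed.

End DataPermutation.

(** * The finite identity for a fixed dataset *)

Section PointwiseUniform.
Context {R : realType} {d : nat}.
Variable sel : selection_rule R d.
Notation pt := (d.-tuple R).
Notation obs := (@observation R d).

Definition time_le (a b : obs) : bool := a.1.2 <= b.1.2.

Definition transform_mean (D : seq obs) (phi : seq (pt * R) -> R) : R :=
  let D' := sort time_le D in
  let xs := [seq o.1.1 | o <- D'] in
  loop_mean sel D' xs xs phi.

Definition permute_covariates n (g : 'S_n) (D : n.-tuple obs) : n.-tuple obs :=
  [tuple ((tnth D (g i)).1.1, (tnth D i).1.2, (tnth D i).2) | i < n].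

Lemma loop_mean_sum I (r : seq I) (F : I -> seq (pt * R) -> R) D AR L :
  loop_mean sel D AR L (fun s => \sum_(i <- r) F i s) =
  \sum_(i <- r) loop_mean sel D AR L (F i).
Proof.
elim: D AR L F => // -[[x z] delta] D IHD AR L F /=.
case: D IHD => // o D IHD; case: delta; last exact: IHD.
rewrite exchange_big; apply: eq_bigr => j _.
by rewrite (IHD _ _ (fun i s => F i ((tnth (in_tuple L) j, z) :: s))) mulr_sumr.
Qed.

Lemma transform_mean_sum I (r : seq I) (F : I -> seq (pt * R) -> R) D :
  transform_mean D (fun s => \sum_(i <- r) F i s) =
  \sum_(i <- r) transform_mean D (F i).
Proof. exact: loop_mean_sum. Qed.

Lemma size_output_times (zs : seq (R * bool)) l :
  (0 < size zs)%N -> (size zs <= l)%N -> size (output_times zs l) = l.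
Proof.
elim: zs l => // -[z delta] zs IHzs l _ /= sl.
case: zs IHzs sl => [|o zs] IHzs sl; first by rewrite size_nseq.
case: delta => /=; last by rewrite IHzs // ltnW.
by rewrite IHzs; case: l sl.
Qed.

Hypothesis sel_rule : optimal_selection_rule sel.

(** The right-hand side does not depend on the dataset: averaging over [g] turns the loop into a
    uniform ordering of the covariates, and the count becomes that of [sum_rank_of_first] over B+1
    free permutations and all tie-breakings. *)
Lemma sum_transform_mean n B (D : n.-tuple obs) k :
  (0 < n)%N -> (1 <= k <= B.+1)%N ->
  (\sum_(g : 'S_n) \sum_(pi : {ffun 'I_B -> 'S_n}) \sum_(tau : 'S_B.+1)
     transform_mean (permute_covariates g D)
       (fun s => (rank_of_first (HSIC_values s pi) tau == k)%:R)) * B.+1%:R =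
  (n`! ^ B.+1 * (B.+1)`!)%:R.
Proof.
move=> n0 kB.
pose x i := (tnth D i).1.1; pose z i := ((tnth D i).1.2, (tnth D i).2).
(* The sorting order depends on the times alone, hence is common to all [g]. *)
pose o := sort (fun i j => (z i).1 <= (z j).1) (enum 'I_n).
pose zs := [seq z i | i <- o].
pose phi s : R := (@rank_count R d n B k s)%:R.
have so : size o == n by rewrite size_sort size_enum_ord.
have szs : size zs = n by rewrite size_map (eqP so).
have sortE g : sort time_le (permute_covariates g D) =
    attach [seq x (g i) | i <- o] zs.
  by rewrite /permute_covariates /= sort_map /attach zip_map -map_comp.
have [p oE] : exists p : 'S_n, o = [seq p i | i <- enum 'I_n].
  have /tuple_permP[p pE] : perm_eq (Tuple so) (ord_tuple n).
    by rewrite /= perm_sort.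
  exists p; transitivity (tval (Tuple so)); first by []; rewrite pE /=.
  by apply: eq_map => i; rewrite tnth_ord_tuple.
have phi_perm s s' : size s = n -> perm_eq s s' -> phi s = phi s'.
  by move=> sn ss'; rewrite /phi (rank_count_perm _ _ sn ss').
pose X := [seq x i | i <- enum 'I_n].
have sX : size X = n by rewrite size_map size_enum_ord.
pose psi xs := loop_mean sel (attach xs zs) xs X phi.
transitivity ((\sum_(g : 'S_n) psi [seq x (g i) | i <- enum 'I_n]) * B.+1%:R).
  (* Sorting acts as the permutation [p], which the sum over the whole group absorbs. *)
  congr (_ * _); rewrite [RHS](reindex_inj (mulgI p)); apply: eq_bigr => g _.
  have -> : [seq x ((p * g)%g i) | i <- enum 'I_n] = [seq x (g i) | i <- o].
    rewrite oE -[RHS]map_comp; apply: eq_map => i; by rewrite /= permM.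
  rewrite /psi -(@loop_mean_perm _ _ _ sel_rule _ _ [seq x (g i) | i <- o] X).
  - transitivity (transform_mean (permute_covariates g D) phi).
      rewrite (_ : phi = fun s => \sum_(pi : {ffun 'I_B -> 'S_n}) \sum_(tau : 'S_B.+1)
        (rank_of_first (HSIC_values s pi) tau == k)%:R); last first.
        apply/funext => s; rewrite /phi natr_sum; apply: eq_bigr => pi _.
        by rewrite natr_sum.
      rewrite transform_mean_sum; apply: eq_bigr => pi _.
      by rewrite transform_mean_sum.
    rewrite /transform_mean sortE; congr (loop_mean sel _ _ _ phi).
      by rewrite /attach zip_map -!map_comp.
    by rewrite /attach zip_map -!map_comp.
  - by rewrite /attach zip_map !size_map.
  - by move=> s s'; rewrite size_map (eqP so); apply: phi_perm.
  - rewrite (_ : [seq x (g i) | i <- o] = [seq x i | i <- [seq g i | i <- o]]); last first.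
      by rewrite -[RHS]map_comp.
    apply: perm_map; apply: uniq_perm; rewrite ?enum_uniq //.
      by rewrite map_inj_uniq ?sort_uniq ?enum_uniq //; exact: perm_inj.
    move=> i; rewrite mem_enum; apply/mapP; exists (g^-1%g i); rewrite ?permKV //.
    by rewrite mem_sort mem_enum.
rewrite (sum_perm_ordering_mean x psi) -/X.
rewrite (ordering_mean_loop sel_rule) ?szs ?sX //.
rewrite -(sum_perm_ordering_mean x (fun ys => phi (zip ys (output_times zs n)))).
pose t := output_times zs n.
have st : size t = n by rewrite size_output_times ?szs.
pose H (g : 'S_n) : R := HSIC (fun i => (x (g i), nth 0 t i)).
have dE (g : 'S_n) i : dataset (zip [seq x (g i) | i <- enum 'I_n] t) i = (x (g i), nth 0 t i).
  have sxg : size [seq x (g i) | i <- enum 'I_n] = n by rewrite size_map size_enum_ord.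
  rewrite /dataset nth_zip ?sxg ?st //; congr (_, _); rewrite (nth_map i) ?size_enum_ord //.
  by rewrite nth_ord_enum.
(* The product [pi b * g] sends [i] to [g (pi b i)], so each permuted dataset is again the
   covariates in some order attached to the times [t]. The map is inverted below by dividing by the
   entry at [ord0]. *)
pose q (g : 'S_n) (pi : {ffun 'I_B -> 'S_n}) : {ffun 'I_B.+1 -> 'S_n} :=
  [ffun j => if unlift ord0 j is Some b then (pi b * g)%g else g].
have HE (g : 'S_n) (pi : {ffun 'I_B -> 'S_n}) :
    HSIC_values (zip [seq x (g i) | i <- enum 'I_n] t) pi = H \o q g pi.
  apply/funext => j; rewrite /HSIC_values /= ffunE; case: unlift => [b|].
    congr HSIC; apply/funext => i; by rewrite /permute_data !dE permM.
  by congr HSIC; apply/funext => i; rewrite dE.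
rewrite -natr_sum -natrM; congr _%:R.
rewrite -[in RHS]card_Sn -(@sum_rank_of_first _ _ H _ k kB); congr (_ * _)%N.
transitivity (\sum_(gp : 'S_n * {ffun 'I_B -> 'S_n}) \sum_(tau : 'S_B.+1)
    (rank_of_first (H \o q gp.1 gp.2) tau == k))%N.
  rewrite -(pair_bigA _ (fun g pi => \sum_(tau : 'S_B.+1)
    (rank_of_first (H \o q g pi) tau == k)))%N /=.
  by apply: eq_bigr => g _; apply: eq_bigr => pi _; rewrite -HE.
pose r (f : {ffun 'I_B.+1 -> 'S_n}) : 'S_n * {ffun 'I_B -> 'S_n} :=
  (f ord0, [ffun b => (f (lift ord0 b) * (f ord0)^-1)%g]).
rewrite (reindex (fun gp => q gp.1 gp.2)) //=.
exists r => [[g pi] _|f _]; rewrite /r /q /=.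
  congr pair; first by rewrite ffunE unlift_none.
  by apply/ffunP => b; rewrite !ffunE liftK unlift_none mulgK.
apply/ffunP => j; rewrite !ffunE; case: unliftP => [b ->|-> //].
by rewrite ffunE mulgVK.
Qed.

End PointwiseUniform.

(** * Laws of random tuples *)

Definition rectangle {T : Type} {n} (A : 'I_n -> set T) : set (n.-tuple T) :=
  [set t | forall i, A i (tnth t i)].

Section TupleLaws.
Context {dT : measure_display} {T : measurableType dT} {n : nat} {R : realType}.
Local Open Scope ereal_scope.

Lemma measurable_rectangle (A : 'I_n -> set T) :
  (forall i, measurable (A i)) -> measurable (rectangle A).
Proof.
move=> mA; rewrite (_ : rectangle A = \big[setI/setT]_(i < n) [set t | A i (tnth t i)]).
  apply: bigsetI_measurable => i _; rewrite -[X in measurable X]setTI.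
  exact: (@measurable_tnth _ T n i) (mA i).
apply/seteqP; split => t /=; rewrite -bigcap_seq /=.
  by move=> At i _; exact: At.
by move=> At i; apply: At; rewrite /= mem_index_enum.
Qed.

(** A coordinate preimage is a rectangle whose other sides are [setT]. Unlike such preimages,
    rectangles are stable under intersection, as uniqueness of measures requires. *)
Lemma measurable_tuple_rectangles :
  @measurable _ (n.-tuple T) =
  <<s [set S | exists2 A : 'I_n -> set T, (forall i, measurable (A i)) & S = rectangle A] >>.
Proof.
apply/seteqP; split; apply: smallest_sub.
- exact: smallest_sigma_algebra.
- rewrite -bigcup_seq => S /= [i _ [A mA <-]]; apply: sub_sigma_algebra.
  exists (fun j => if j == i then A else setT).
    by move=> j; case: ifP.
  apply/seteqP; split => t /=; rewrite /rectangle /=.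
    by move=> [_ At] j; case: eqP => // ->.
  by move=> /(_ i); rewrite eqxx.
- exact: sigma_algebra_measurable.
- by move=> S [A mA ->]; exact: measurable_rectangle.
Qed.

Lemma tuple_measure_unique (m1 m2 : {measure set (n.-tuple T) -> \bar R}) :
  m1 setT < +oo ->
  (forall A : 'I_n -> set T, (forall i, measurable (A i)) ->
     m1 (rectangle A) = m2 (rectangle A)) ->
  forall S, measurable S -> m1 S = m2 S.
Proof.
move=> m1oo m12 S mS.
apply: (measure_unique _ (fun=> setT) measurable_tuple_rectangles) => //.
- move=> _ _ [A mA ->] [A' mA' ->]; exists (fun i => A i `&` A' i).
    by move=> i; exact: measurableI.
  apply/seteqP; split => t /=; first by move=> [h h'] i; split.
  by move=> h; split => i; case: (h i).
- move=> _; exists (fun=> setT) => //.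
  by apply/seteqP; split.
- by rewrite bigcup_const.
- by move=> _ [A mA ->]; exact: m12.
Qed.

End TupleLaws.

Section RandomTuples.
Context {dO : measure_display} {Omega : measurableType dO} {R : realType}.
Variable P : probability Omega R.
Context {dT : measure_display} {T : measurableType dT} {n : nat}.
Local Open Scope ereal_scope.
Implicit Types V : Omega -> n.-tuple T.

Lemma eq_tuple_law V V' : measurable_fun setT V -> measurable_fun setT V' ->
  (forall A : 'I_n -> set T, (forall i, measurable (A i)) ->
     P (V @^-1` rectangle A) = P (V' @^-1` rectangle A)) ->
  forall S, measurable S -> P (V @^-1` S) = P (V' @^-1` S).
Proof.
move=> mV mV' VV' S mS.
pose f : {mfun Omega >-> n.-tuple T} := mfun_Sub (mem_set mV).
pose f' : {mfun Omega >-> n.-tuple T} := mfun_Sub (mem_set mV').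
apply: (tuple_measure_unique (m1 := distribution P f) (m2 := distribution P f')) => //.
by apply: le_lt_trans (probability_le1 (distribution P f) measurableT) (ltry _).
Qed.

(** Both sides, as functions of [S], are finite measures: the law of [V] restricted to [E], and the
    law of [V] scaled by [P E]. Agreement on rectangles suffices. *)
Lemma indep_event_tuple V (E : set Omega) : measurable_fun setT V -> measurable E ->
  (forall A : 'I_n -> set T, (forall i, measurable (A i)) ->
     P (V @^-1` rectangle A `&` E) = P (V @^-1` rectangle A) * P E) ->
  forall S, measurable S -> P (V @^-1` S `&` E) = P (V @^-1` S) * P E.
Proof.
move=> mV mE VE S mS.
pose f : {mfun Omega >-> n.-tuple T} := mfun_Sub (mem_set mV).
have PE : P E = (fine (P E))%:E by rewrite fineK // fin_num_measure.
pose c : {nonneg R} := NngNum (fine_ge0 (measure_ge0 P E)).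
rewrite muleC PE.
have := tuple_measure_unique (m1 := pushforward (mrestr P mE) f)
  (m2 := mscale c (pushforward P f)) _ _ mS; apply.
  change (P (V @^-1` setT `&` E) < +oo); rewrite preimage_setT setTI.
  by apply: le_lt_trans (probability_le1 P mE) (ltry _).
move=> A mA; change (P (V @^-1` rectangle A `&` E) = (fine (P E))%:E * P (V @^-1` rectangle A)).
by rewrite -PE muleC VE.
Qed.

End RandomTuples.

(** * Measurability *)

Section DiscreteValued.
Context {dE : measure_display} {E : measurableType dE}.

(* For values in a countable type that carries no sigma-algebra. *)
Definition discrete_measurable_fun {F : Type} (J : E -> F) :=
  forall j, measurable [set e | J e = j].

(** A countable union over the values of [J]. The measurability proofs below freeze a discrete
    quantity (a length, an index, a pattern of comparisons) in this way, after which the rest has a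
    fixed shape. *)
Lemma measurable_glue {F : countType} (J : E -> F) (Q : F -> set E) :
  discrete_measurable_fun J -> (forall j, measurable (Q j)) ->
  measurable [set e | Q (J e) e].
Proof.
move=> mJ mQ.
rewrite (_ : mkset _ = \bigcup_k
    (if unpickle k is Some j then [set e | J e = j] `&` Q j else set0)).
  apply: bigcupT_measurable => k; case: unpickle => // j.
  exact: measurableI.
apply/seteqP; split => e /=.
  by move=> Qe; exists (pickle (J e)) => //; rewrite pickleK.
by move=> [k _]; case: unpickle => // j [/= -> ].
Qed.

Lemma measurable_fun_glue {F : countType} {dT : measure_display}
    {T : measurableType dT} (J : E -> F) (g : F -> E -> T) :
  discrete_measurable_fun J -> (forall j, measurable_fun setT (g j)) ->
  measurable_fun setT (fun e => g (J e) e).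
Proof.
move=> mJ mg _ Y mY; rewrite setTI.
apply: (measurable_glue (Q := fun j => g j @^-1` Y)) => // j.
by rewrite -[X in measurable X]setTI; exact: mg.
Qed.

Lemma discrete_glue {F : countType} {F' : Type} (J : E -> F) (g : F -> E -> F') :
  discrete_measurable_fun J -> (forall j, discrete_measurable_fun (g j)) ->
  discrete_measurable_fun (fun e => g (J e) e).
Proof.
move=> mJ mg j; apply: (measurable_glue (Q := fun i => [set e | g i e = j])) => // i.
exact: mg.
Qed.

Lemma discrete_cst {F : Type} (c : F) : discrete_measurable_fun (fun=> c).
Proof.
move=> j; have [->|cj] := pselect (c = j).
  by rewrite (_ : mkset _ = setT) //; apply/seteqP; split.
by rewrite (_ : mkset _ = set0) //; apply/seteqP; split.
Qed.

Lemma discrete_comp {F : countType} {F' : Type} (J : E -> F) (h : F -> F') :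
  discrete_measurable_fun J -> discrete_measurable_fun (fun e => h (J e)).
Proof.
by move=> mJ; apply: (discrete_glue (g := fun j _ => h j)) => // j; exact: discrete_cst.
Qed.

Lemma discrete_comp2 {F F' : countType} {F'' : Type} (J : E -> F) (K : E -> F')
    (h : F -> F' -> F'') :
  discrete_measurable_fun J -> discrete_measurable_fun K ->
  discrete_measurable_fun (fun e => h (J e) (K e)).
Proof.
move=> mJ mK; apply: (discrete_glue (g := fun j e => h j (K e))) => // j.
exact: discrete_comp.
Qed.

Lemma discrete_map {F : countType} {I : Type} (r : seq I) (b : I -> E -> F) :
  (forall i, discrete_measurable_fun (b i)) ->
  discrete_measurable_fun (fun e => [seq b i e | i <- r]).
Proof.
move=> mb; elim: r => [|i r IHr] /=; first exact: discrete_cst.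
exact: (discrete_comp2 (@cons F)).
Qed.

Lemma discrete_bool (f : E -> bool) :
  measurable_fun setT f <-> discrete_measurable_fun f.
Proof.
split=> [mf b|mf].
  by rewrite -[X in measurable X]setTI; apply: (mf measurableT [set b]).
move=> _ Y _; rewrite setTI.
apply: (measurable_glue (Q := fun j => [set e | Y j])) => // j.
have [Yj|Yj] := pselect (Y j).
  by rewrite (_ : mkset _ = setT) //; apply/seteqP; split.
by rewrite (_ : mkset _ = set0) //; apply/seteqP; split.
Qed.

End DiscreteValued.

Section MeasurableSeq.
Context {dE : measure_display} {E : measurableType dE}.
Context {dT : measure_display} {T : measurableType dT}.
Variable x0 : T.

(* Sequences carry no sigma-algebra; the default x0 makes every coordinate a
   total function, equal to x0 beyond the end of f e. *)
Definition measurable_seq (f : E -> seq T) :=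
  discrete_measurable_fun (fun e => size (f e)) /\
  forall i, measurable_fun setT (fun e => nth x0 (f e) i).

Lemma measurable_seq_glue {F : countType} (J : E -> F) (g : F -> E -> seq T) :
  discrete_measurable_fun J -> (forall j, measurable_seq (g j)) ->
  measurable_seq (fun e => g (J e) e).
Proof.
move=> mJ mg; split=> [|i].
  by apply: (discrete_glue (g := fun j e => size (g j e))) => // j; case: (mg j).
by apply: (measurable_fun_glue (g := fun j e => nth x0 (g j e) i)) => // j; case: (mg j).
Qed.

Lemma measurable_seq_map {I : Type} (r : seq I) (f : I -> E -> T) :
  (forall i, measurable_fun setT (f i)) ->
  measurable_seq (fun e => [seq f i e | i <- r]).
Proof.
move=> mf; split=> [|j].
  by under [X in discrete_measurable_fun X]eq_fun do rewrite size_map; exact: discrete_cst.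
have [jr|jr] := ltnP j (size r); last first.
  rewrite (_ : (fun _ => _) = fun=> x0); first exact: measurable_cst.
  by apply/funext => e; rewrite nth_default // size_map.
case: r jr => // i0 r jr.
rewrite (_ : (fun _ => _) = f (nth i0 (i0 :: r) j)) //.
by apply/funext => e; rewrite (nth_map i0).
Qed.

Lemma measurable_seq_cons (x : E -> T) s :
  measurable_fun setT x -> measurable_seq s -> measurable_seq (fun e => x e :: s e).
Proof.
move=> mx [ms1 ms2]; split=> [|[|i]] //=.
exact: (discrete_comp S ms1).
Qed.

End MeasurableSeq.

Section MeasurablePoints.
Context {dE : measure_display} {E : measurableType dE} {R : realType} {d : nat}.
Notation pt := (d.-tuple R).
Implicit Types (x y : E -> pt) (s : E -> seq pt).

Lemma discrete_point_eq x y : measurable_fun setT x -> measurable_fun setT y ->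
  discrete_measurable_fun (fun e => x e == y e).
Proof.
move=> /measurable_fun_tnthP mx /measurable_fun_tnthP my.
rewrite (_ : (fun e => _) =
    fun e => all id [seq tnth (x e) i == tnth (y e) i | i <- enum 'I_d]).
  apply: discrete_comp; apply: discrete_map => i; apply/discrete_bool.
  exact: (measurable_fun_eqr (mx i) (my i)).
apply/funext => e; rewrite all_map; apply/eqP/allP => [-> i _|exy] /=.
  by rewrite eqxx.
by apply: eq_from_tnth => i; apply/eqP/exy; rewrite mem_enum.
Qed.

(** The index of the removed point is discrete; once it is frozen, the result is a fixed splice of
    the coordinates. *)
Lemma measurable_seq_rem x s : measurable_fun setT x ->
  measurable_seq origin s -> measurable_seq origin (fun e => rem (x e) (s e)).
Proof.
move=> mx [ms1 ms2].
have mk : discrete_measurable_fun (fun e => index (x e) (s e)).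
  rewrite (_ : (fun e => _) = fun e => find id
      [seq nth origin (s e) i == x e | i <- iota 0 (size (s e))]).
    apply: (discrete_glue (g := fun m e => find id
      [seq nth origin (s e) i == x e | i <- iota 0 m])) => // m.
    apply: discrete_comp; apply: discrete_map => i; exact: discrete_point_eq.
  apply/funext => e; rewrite /index -[in LHS](mkseq_nth origin (s e)) find_map.
  by rewrite find_map.
rewrite (_ : (fun e => _) = fun e => take (index (x e) (s e)) (s e) ++
    drop (index (x e) (s e)).+1 (s e)); last by apply/funext => e; rewrite remE.
apply: (measurable_seq_glue (g := fun k e => take k (s e) ++ drop k.+1 (s e))) => // k.
split=> [|i].
  rewrite (_ : (fun e => _) = fun e => (minn k (size (s e)) + (size (s e) - k.+1))%N).
    exact: (discrete_comp (fun m => minn k m + (m - k.+1))%N ms1).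
  by apply/funext => e; rewrite size_cat size_take_min size_drop.
have [ik|ki] := ltnP i k.
  rewrite (_ : (fun e => _) = fun e => nth origin (s e) i) //.
  apply/funext => e; rewrite nth_cat size_take_min leq_min ik /=.
  case: ltnP => si; first by rewrite nth_take.
  by rewrite !nth_default // size_drop; lia.
rewrite (_ : (fun e => _) = fun e => nth origin (s e) i.+1) //.
apply/funext => e; rewrite nth_cat size_take_min leq_min ltnNge ki /=.
rewrite nth_drop; have [ks|sk] := leqP k (size (s e)).
  by congr nth; lia.
by rewrite !nth_default //; lia.
Qed.

End MeasurablePoints.

Lemma measurable_sum_cond {dE : measure_display} {E : measurableType dE} {R : realType}
    (I : finType) (P : pred I) (h : I -> E -> R) :
  (forall i, measurable_fun setT (h i)) ->
  measurable_fun setT (fun e => \sum_(i | P i) h i e).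
Proof.
move=> mh; rewrite (_ : (fun e => _) = fun e => \sum_i if P i then h i e else 0).
  by apply: measurable_sum => i; case: (P i); [exact: mh|exact: measurable_cst].
by apply/funext => e; rewrite big_mkcond.
Qed.

Section TransformMeasurable.
Context {dE : measure_display} {E : measurableType dE} {R : realType} {d : nat}.
Variable sel : selection_rule R d.
Hypothesis sel_rule : optimal_selection_rule sel.
Notation pt := (d.-tuple R).
Notation obs := (@observation R d).

Definition sample_point (AR L : seq pt) (x : pt) (u : R) : pt :=
  sample_from (in_tuple L) (loop_weight sel AR x) u.

Lemma sample_point_tuple m k (A : m.-tuple pt) (L : k.-tuple pt) x u :
  sample_point A L x u = sample_from L (cond_coupling A (sel A L) x) u.
Proof.
case: A => A /[dup] /eqP hA; case: L => L /[dup] /eqP hL /=; subst m k => pL pA.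
by rewrite (eq_irrelevance pL (eqxx _)) (eq_irrelevance pA (eqxx _)).
Qed.

Lemma measurable_seq_tuple m (s : E -> seq pt) : measurable_seq origin s ->
  measurable_fun setT (fun e => [tuple nth origin (s e) i | i < m] : m.-tuple pt).
Proof.
move=> [_ ms]; apply/measurable_fun_tnthP => i.
rewrite (_ : _ \o _ = fun e => nth origin (s e) i); first exact: ms.
by apply/funext => e; rewrite /= tnth_mktuple.
Qed.

Lemma measurable_sample_from m k (A : E -> m.-tuple pt) (L : E -> k.-tuple pt)
    (x : E -> pt) (u : E -> R) :
  measurable_fun setT A -> measurable_fun setT L -> measurable_fun setT x ->
  measurable_fun setT u ->
  measurable_fun setT (fun e =>
    sample_from (L e) (cond_coupling (A e) (sel (A e) (L e)) (x e)) (u e)).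
Proof.
move=> mA mL mx mu; have [_ _ mW] := sel_rule.
have mWij i j : measurable_fun setT (fun e => sel (A e) (L e) i j).
  exact: (measurableT_comp (mW m k i j) (measurable_fun_pair mA mL)).
have mAi i : measurable_fun setT (fun e => tnth (A e) i).
  by have /measurable_fun_tnthP := mA; apply.
have mLi i : measurable_fun setT (fun e => tnth (L e) i).
  by have /measurable_fun_tnthP := mL; apply.
(* The pattern of positions holding [x] decides which entries of the coupling are summed; with it
   frozen, the conditional weights are fixed expressions in these entries. *)
pose J e := [seq tnth (A e) i == x e | i <- enum 'I_m].
have mJ : discrete_measurable_fun J.
  by apply: discrete_map => i; exact: discrete_point_eq.
pose v b e (j : 'I_k) := (\sum_(i < m | nth false b i) sel (A e) (L e) i j) /
  (\sum_(i < m | nth false b i) m%:R^-1).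
have vE e : cond_coupling (A e) (sel (A e) (L e)) (x e) = v (J e) e.
  have JE (i : 'I_m) : nth false (J e) i = (tnth (A e) i == x e).
    by rewrite (nth_map i) ?size_enum_ord // nth_ord_enum.
  apply/funext => j; rewrite /cond_coupling /v.
  by congr (_ / _); apply: eq_bigl => i; rewrite JE.
have mv b j : measurable_fun setT (fun e => v b e j).
  apply: measurable_funM; last exact: measurable_cst.
  exact: measurable_sum_cond.
under eq_fun do rewrite vE.
apply: (measurable_fun_glue (g := fun b e => sample_from (L e) (v b e) (u e))) => // b.
rewrite /sample_from.
pose K e := find id [seq u e < \sum_(i < k | (i <= j)%N) v b e i | j : 'I_k <- enum 'I_k].
have mK : discrete_measurable_fun K.
  apply: discrete_comp; apply: discrete_map => j; apply/discrete_bool.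
  by apply: measurable_fun_ltr => //; exact: measurable_sum_cond.
rewrite (_ : (fun e => _) = fun e => nth origin (L e) (K e)); last first.
  by apply/funext => e; rewrite /K find_map.
apply: (measurable_fun_glue (g := fun j e => nth origin (L e) j)) => // j.
have [jk|kj] := ltnP j k.
  rewrite (_ : (fun e => _) = fun e => tnth (L e) (Ordinal jk)) //.
  by apply/funext => e; rewrite (tnth_nth origin).
rewrite (_ : (fun e => _) = fun=> origin); first exact: measurable_cst.
by apply/funext => e; rewrite nth_default // size_tuple.
Qed.

Lemma measurable_sample_point (A L : E -> seq pt) (x : E -> pt) (u : E -> R) :
  measurable_seq origin A -> measurable_seq origin L -> measurable_fun setT x ->
  measurable_fun setT u ->
  measurable_fun setT (fun e => sample_point (A e) (L e) (x e) (u e)).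
Proof.
move=> mA mL mx mu.
(* The list forced to length [m], equal to [s e] when [m] is its true size; freezing the sizes then
   gives tuples of a constant type. *)
pose T m (s : E -> seq pt) e : m.-tuple pt := [tuple nth origin (s e) i | i < m].
have TE s e : s e = T (size (s e)) s e.
  apply: (@eq_from_nth _ origin); rewrite ?size_tuple // => i si.
  by rewrite -[i]/(val (Ordinal si)) -tnth_nth tnth_mktuple.
rewrite (_ : (fun e => _) = fun e => sample_point (T (size (A e)) A e)
    (T (size (L e)) L e) (x e) (u e)); last first.
  by apply/funext => e; rewrite -!TE.
apply: (measurable_fun_glue (g := fun m e => sample_point (T m A e)
    (T (size (L e)) L e) (x e) (u e))); first by case: mA.
move=> m; apply: (measurable_fun_glue (g := fun k e => sample_point (T m A e)
    (T k L e) (x e) (u e))); first by case: mL.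
move=> k; under eq_fun do rewrite sample_point_tuple.
by apply: measurable_sample_from => //; exact: measurable_seq_tuple.
Qed.

(** The inputs are lists of random elements rather than random lists, so that the number of
    iterations is deterministic and induction applies. Membership is [List.In], functions having no
    decidable equality. *)
Lemma measurable_transform_loop (O : seq (E -> obs)) (us : seq (E -> R)) (A L : E -> seq pt) :
  (forall o, List.In o O -> measurable_fun setT o) ->
  (forall u, List.In u us -> measurable_fun setT u) ->
  measurable_seq origin A -> measurable_seq origin L ->
  @measurable_seq _ E _ (pt * R)%type (origin, 0) (fun e => transform_loop sel [seq o e | o <- O]
    [seq u e | u <- us] (A e) (L e)).
Proof.
elim: O us A L => [|o O IHO] us A L mO mus mA mL.
  by split=> [|i] /=; [exact: discrete_cst|exact: measurable_cst].
have mo : measurable_fun setT o by apply: mO; left.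
have mox : measurable_fun setT (fun e => (o e).1.1).
  by do 2 apply: (measurableT_comp measurable_fst).
have moz : measurable_fun setT (fun e => (o e).1.2).
  apply: (measurableT_comp measurable_snd).
  exact: (measurableT_comp measurable_fst).
have mod : discrete_measurable_fun (fun e => (o e).2).
  by apply/discrete_bool; apply: (measurableT_comp measurable_snd).
case: O IHO mO => [|o' O] IHO mO.
  rewrite (_ : (fun e => _) = fun e => [seq (y, (o e).1.2) | y <- L e]); last first.
    by apply/funext => e /=; case: (o e) => -[].
  case: mL => mL1 mL2; split=> [|i].
    by under [X in discrete_measurable_fun X]eq_fun do rewrite size_map.
  rewrite (_ : (fun e => _) = fun e => if (i < size (L e))%N
      then (nth origin (L e) i, (o e).1.2) else (origin, 0)).
    apply: (measurable_fun_glue (g := fun (b : bool) e => if b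
      then (nth origin (L e) i, (o e).1.2) else (origin, 0))).
      exact: (discrete_comp (fun m => i < m)%N).
    by case; [exact: measurable_fun_pair|exact: measurable_cst].
  apply/funext => e; case: ltnP => iL; first by rewrite (nth_map origin).
  by rewrite nth_default // size_map.
have mbehead : exists2 us', forall u, List.In u us' -> measurable_fun setT u &
    forall e, behead [seq u e | u <- us] = [seq u e | u <- us'].
  case: us mus => [|u us] mus; first by exists [::].
  by exists us => // u' u'us; apply: mus; right.
pose head_u e := head 0 [seq u e | u <- us].
have mhead : measurable_fun setT head_u.
  rewrite /head_u; case: (us) mus => [|u us''] mus'' /=; first exact: measurable_cst.
  by apply: mus''; left.
have [us' mus' us'E] := mbehead.
pose y e := sample_point (A e) (L e) (o e).1.1 (head_u e).
have my : measurable_fun setT y by exact: measurable_sample_point.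
have mAr := measurable_seq_rem mox mA; have mLr := measurable_seq_rem my mL.
have mO' o1 : List.In o1 (o' :: O) -> measurable_fun setT o1 by move=> ?; apply: mO; right.
pose g (b : bool) e := if b then (y e, (o e).1.2) :: transform_loop sel
      [seq o e | o <- o' :: O] [seq u e | u <- us'] (rem (o e).1.1 (A e)) (rem (y e) (L e))
    else transform_loop sel [seq o e | o <- o' :: O] [seq u e | u <- us']
      (rem (o e).1.1 (A e)) (L e).
rewrite (_ : (fun e => _) = fun e => g (o e).2 e); last first.
  apply/funext => e; rewrite /g -us'E /y /head_u /=.
  by case: (o e) => -[x z] [].
apply: (measurable_seq_glue (g := g)) => // -[]; last exact: IHO.
apply: measurable_seq_cons; first exact: measurable_fun_pair.
exact: IHO.
Qed.

End TransformMeasurable.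

(** * Inverse-transform sampling *)

Lemma measure_partition {d : measure_display} {T : measurableType d} {R : realType}
    (mu : {measure set T -> \bar R}) {F : finType} (J : T -> F) (A : set T) :
  measurable A -> discrete_measurable_fun J ->
  mu A = (\sum_(j : F) mu (A `&` [set t | J t = j]))%E.
Proof.
move=> mA mJ.
have H (r : seq F) : uniq r ->
    mu (A `&` [set t | J t \in r]) = (\sum_(j <- r) mu (A `&` [set t | J t = j]))%E.
  elim: r => [|j r IHr] /=.
    by rewrite big_nil (_ : _ `&` _ = set0) ?measure0 //; apply/seteqP; split => t // [].
  case/andP => jr ur; rewrite big_cons -IHr //.
  rewrite -measureU.
  - congr (mu _); apply/seteqP; split => t /=.
      by rewrite in_cons => -[At /orP[/eqP|]]; [left|right].
    by rewrite in_cons => -[[At ->]|[At ->]]; rewrite ?eqxx ?orbT.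
  - exact: measurableI.
  - apply: measurableI => //.
    by apply: (measurable_glue (Q := fun j => [set e | j \in r])) => // j'; exact: discrete_cst.
  - by apply/seteqP; split => t // [[_ /= ->] [_ /=]]; rewrite (negbTE jr).
rewrite -[in RHS]big_enum /= -H ?enum_uniq //; congr (mu _); apply/seteqP; split => t /=.
  by move=> At; rewrite mem_enum.
by case.
Qed.

Section InverseTransform.
Context {R : realType} {k : nat}.
Variable v : 'I_k -> R.
Hypothesis v_ge0 : forall j, 0 <= v j.
Hypothesis v_sum1 : \sum_j v j = 1.

Definition cumulative (j : nat) : R := \sum_(i < k | (i < j)%N) v i.

Definition sample_index (u : R) : nat :=
  find (fun j : 'I_k => u < \sum_(i < k | (i <= j)%N) v i) (enum 'I_k).

Lemma cumulativeS (j : 'I_k) : cumulative j.+1 = cumulative j + v j.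
Proof.
rewrite /cumulative (bigD1 j) ?ltnSn //= addrC; congr (_ + _).
by apply: eq_bigl => i; rewrite ltnS [RHS]ltn_neqAle andbC.
Qed.

Lemma le_cumulative i j : (i <= j)%N -> cumulative i <= cumulative j.
Proof.
move=> ij; rewrite /cumulative big_mkcond [leRHS]big_mkcond; apply: ler_sum => l _.
case: (ltnP l i) => li; first by rewrite (leq_trans li ij).
by case: ifP.
Qed.

Lemma cumulative_max : cumulative k = 1.
Proof. by rewrite -v_sum1; apply: eq_bigl => i; rewrite ltn_ord. Qed.

(** The search stops at the first cumulative sum above [u], and these sums are nondecreasing. The
    sign of [u] gives the lower bound at [j = 0]. *)
Lemma sample_indexP (u : R) (j : 'I_k) : 0 <= u ->
  (sample_index u == j) = (cumulative j <= u < cumulative j.+1).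
Proof.
move=> u0; set a := fun j : 'I_k => u < \sum_(i < k | (i <= j)%N) v i.
have aE (i : 'I_k) : a i = (u < cumulative i.+1).
  by rewrite /a /cumulative; congr (_ < _); apply: eq_bigl.
have nthE i (ik : (i < k)%N) : nth j (enum 'I_k) i = Ordinal ik.
  by apply: val_inj; rewrite /= nth_enum_ord.
rewrite /sample_index -/a; apply/eqP/andP => [fj|[cu uc]].
  have hasa : has a (enum 'I_k) by rewrite has_find fj size_enum_ord.
  have := nth_find j hasa; rewrite fj nthE aE /= => ->; split => //.
  case: (posnP j) => [->|j0]; first by rewrite /cumulative big_pred0.
  have jk : (j.-1 < k)%N by rewrite (leq_ltn_trans (leq_pred _) (ltn_ord j)).
  have : (j.-1 < find a (enum 'I_k))%N by rewrite fj prednK.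
  move=> /(before_find j); rewrite (nthE _ jk) aE /= prednK // => /negbT.
  by rewrite -leNgt.
apply/eqP; rewrite eqn_leq; apply/andP; split; rewrite leqNgt; apply/negP => h.
  by have := before_find j h; rewrite nthE aE /= uc.
have hk : (find a (enum 'I_k) < k)%N by apply: ltn_trans h (ltn_ord j).
have hasa : has a (enum 'I_k) by rewrite has_find size_enum_ord.
have := nth_find j hasa; rewrite (nthE _ hk) aE /= => ul.
have := lt_le_trans ul (le_cumulative h); by rewrite ltNge cu.
Qed.

Lemma sample_index_lt (u : R) : u < 1 -> (sample_index u < k)%N.
Proof.
move=> u1; rewrite /sample_index -[X in (_ < X)%N](size_enum_ord k) -has_find.
have k0 : (0 < k)%N.
  rewrite lt0n; apply/eqP => k0; move: v_sum1; rewrite big1 => [/eqP|i _].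
    by rewrite eq_sym oner_eq0.
  by have := leq_ltn_trans (leq0n i) (ltn_ord i); rewrite [X in (_ < X)%N]k0.
have pk : (k.-1 < k)%N by rewrite prednK.
apply/hasP; exists (Ordinal pk); rewrite ?mem_enum //=.
rewrite (eq_bigl predT) ?v_sum1 // => i.
by rewrite -ltnS prednK ?ltn_ord.
Qed.

End InverseTransform.

Lemma uniform_prob_itvco {R : realType} (a b : R) : 0 <= a -> a <= b -> b <= 1 ->
  uniform_prob (@ltr01 R) `[a, b[%classic = (b - a)%:E.
Proof.
move=> a0 ab b1; rewrite /uniform_prob integral_uniform_pdf setIidl; last first.
  move=> x /=; rewrite !in_itv /= => /andP[ax xb].
  by rewrite (le_trans a0 ax) (le_trans (ltW xb) b1).
rewrite (eq_integral (fun=> 1%E)); last first.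
  move=> x; rewrite inE /= in_itv /= => /andP[ax xb]; rewrite /uniform_pdf.
  by rewrite (le_trans a0 ax) (le_trans (ltW xb) b1) subr0 invr1.
rewrite integral_cst //= mul1e lebesgue_measure_itv /= lte_fin.
by case: ltP => // ba; rewrite (@le_anti _ _ a b) ?ab // subrr.
Qed.

Lemma uniform_prob_setC_unit {R : realType} :
  uniform_prob (@ltr01 R) (~` `[0, 1[%classic) = 0%E.
Proof.
transitivity (1 - uniform_prob (@ltr01 R) `[0%R, 1%R[%classic)%E.
  by apply: (probability_setC (uniform_prob (@ltr01 R))); exact: measurable_itv.
by rewrite uniform_prob_itvco ?ler01 // subr0 subee.
Qed.

(** * The law of the loop for fixed data *)

Section LoopProbability.
Context {dO : measure_display} {Omega : measurableType dO} {R : realType} {d m : nat}.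
Variable P : probability Omega R.
Variable sel : selection_rule R d.
Hypothesis sel_rule : optimal_selection_rule sel.
Variable U : 'I_m -> Omega -> R.
Hypothesis mU : forall i, measurable_fun setT (U i).
Notation pt := (d.-tuple R).

Definition box (A : 'I_m -> set R) : set Omega := [set w | forall i, A i (U i w)].

Hypothesis box_prob : forall A : 'I_m -> set R, (forall i, measurable (A i)) ->
  P (box A) = (\prod_i uniform_prob (@ltr01 R) (A i))%E.

Lemma measurable_box A : (forall i, measurable (A i)) -> measurable (box A).
Proof.
move=> mA; rewrite (_ : box A = \bigcap_i (U i @^-1` A i)); last first.
  by apply/seteqP; split => w h i; [move=> _; exact: h|exact: (h i I)].
apply: fin_bigcap_measurable => // i _; rewrite -[X in measurable X]setTI.
exact: mU.
Qed.

Definition box_update (A : 'I_m -> set R) i B : 'I_m -> set R :=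
  fun j => if j == i then B else A j.

Lemma measurable_box_update A i B : (forall i, measurable (A i)) -> measurable B ->
  forall j, measurable (box_update A i B j).
Proof. by move=> mA mB j; rewrite /box_update; case: ifP. Qed.

Lemma box_update_prob A i B : (forall i, measurable (A i)) -> measurable B ->
  A i = setT ->
  P (box (box_update A i B)) = (P (box A) * uniform_prob (@ltr01 R) B)%E.
Proof.
move=> mA mB Ai; rewrite !box_prob //; last exact: measurable_box_update.
rewrite (bigD1 i) //= [in RHS](bigD1 i) //= Ai probability_setT mul1e muleC.
rewrite /box_update eqxx; congr (_ * _)%E.
by apply: eq_bigr => j /negbTE ->.
Qed.

Lemma discrete_sample_index k (v : 'I_k -> R) i :
  discrete_measurable_fun (fun w => sample_index v (U i w)).
Proof.
rewrite (_ : (fun w => _) = fun w => find id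
    [seq U i w < \sum_(l < k | (l <= j)%N) v l | j : 'I_k <- enum 'I_k]).
  apply: discrete_comp; apply: discrete_map => j; apply/discrete_bool.
  by apply: measurable_fun_ltr => //; exact: measurable_cst.
by apply/funext => w; rewrite find_map.
Qed.

Lemma measurable_loop_event D (s : seq 'I_m) AR L (phi : seq (pt * R) -> bool) :
  measurable [set w | phi (transform_loop sel D [seq U i w | i <- s] AR L)].
Proof.
have cst (b : bool) : measurable [set _ : Omega | b].
  by case: b; [rewrite (_ : mkset _ = setT)|rewrite (_ : mkset _ = set0)] => //;
     apply/seteqP; split.
elim: D s AR L phi => [|[[x z] delta] D IHD] s AR L phi /=; first exact: cst.
case: D IHD => [|o D] IHD; first exact: cst.
have IHb s' AR' L' (phi' : seq (pt * R) -> bool) :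
    measurable [set w | phi' (transform_loop sel (o :: D)
      (behead [seq U i w | i <- s']) AR' L')].
  by case: s' => [|i s']; [exact: (IHD [::])|exact: (IHD s')].
case: delta; last exact: IHb.
set v := cond_coupling _ _ _; case: s => [|i s].
  pose y := sample_from (in_tuple L) v 0.
  exact: (IHD [::] (rem x AR) (rem y L) (fun t => phi ((y, z) :: t))).
apply: (measurable_glue (J := fun w => sample_index v (U i w))
  (Q := fun j => [set w | phi ((nth origin L j, z) :: transform_loop sel (o :: D)
     [seq U i w | i <- s] (rem x AR) (rem (nth origin L j) L))])).
  exact: discrete_sample_index.
by move=> j; exact: (IHD s _ _ (fun t => phi ((nth origin L j, z) :: t))).
Qed.

Lemma loop_weight_ge0 AR L x j : (0 < size AR)%N -> 0 <= loop_weight sel AR (L := L) x j.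
Proof.
move=> AR0; have [opt _ _] := sel_rule.
have L0 : (0 < size L)%N by apply: leq_ltn_trans (ltn_ord j).
have [[W0 _ _] _] := opt _ _ (in_tuple AR) (in_tuple L) AR0 L0.
by rewrite /loop_weight /cond_coupling divr_ge0 ?sumr_ge0 // => i _; rewrite invr_ge0.
Qed.

Lemma loop_weight_sum1 AR L x : (0 < size L)%N -> x \in AR ->
  \sum_j loop_weight sel AR (L := L) x j = 1.
Proof.
move=> L0 xAR; have [opt _ _] := sel_rule.
have AR0 : (0 < size AR)%N by case: AR xAR.
have [[_ rowW _] _] := opt _ _ (in_tuple AR) (in_tuple L) AR0 L0.
rewrite /loop_weight /cond_coupling -mulr_suml exchange_big /=.
under eq_bigr do rewrite rowW.
rewrite mulfV // sumr_const mulrn_eq0 invr_eq0 pnatr_eq0 negb_or -!lt0n AR0 andbT.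
have /tnthP[i xi] : x \in in_tuple AR by [].
by apply/card_gt0P; exists i; rewrite unfold_in; apply/eqP; exact: (congr1 val (esym xi)).
Qed.

(** Induction needs the box [A], which records what past draws imposed on the uniforms already used,
    while those indexed by [s] are still free. The bound on [size D] leaves room for one more
    observation than uniforms, the last one drawing nothing. *)
Lemma loop_event_prob D (s : seq 'I_m) A AR L (phi : seq (pt * R) -> bool) :
  uniq s -> (size D <= (size s).+1)%N -> (forall i, measurable (A i)) ->
  (forall i, i \in s -> A i = setT) -> AR = [seq o.1.1 | o <- D] ->
  (size D <= size L)%N ->
  P (box A `&` [set w | phi (transform_loop sel D [seq U i w | i <- s] AR L)]) =
  (P (box A) * (loop_mean sel D AR L (fun t => (phi t)%:R))%:E)%E.
Proof.
move=> + + mA.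
have cst A' (b : bool) : P (box A' `&` [set _ : Omega | b]) = (P (box A') * (b%:R)%:E)%E.
  case: b; first by rewrite (_ : [set _ | _] = setT) ?setIT ?mule1 //; apply/seteqP; split.
  rewrite (_ : [set _ | _] = set0) ?setI0 ?measure0 ?mule0 //.
  by apply/seteqP; split.
elim: D s A mA AR L phi => [|[[x z] delta] D IHD] s A mA AR L phi us Ds As ARE DL /=.
  exact: cst.
case: D IHD Ds ARE DL => [|o D] IHD /= Ds ARE DL; first exact: cst.
case: s us Ds As => [//|i s] /= /andP[iNs us] Ds As.
have xAR : x \in AR by rewrite ARE mem_head.
have AR0 : (0 < size AR)%N by rewrite ARE.
have L0 : (0 < size L)%N by apply: leq_trans DL.
have ARr : rem x AR = [seq o.1.1 | o <- o :: D] by rewrite ARE /= eqxx.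
have {}As' j : j \in s -> A j = setT by move=> js; apply: As; rewrite in_cons js orbT.
have Ai : A i = setT by apply: As; rewrite mem_head.
case: delta {ARE}; last by apply: IHD => //; exact: ltnW.
pose v := loop_weight sel AR (L := L) x.
have v0 j : 0 <= v j by exact: loop_weight_ge0.
have v1 : \sum_j v j = 1 by exact: loop_weight_sum1.
pose K w := sample_index v (U i w).
(* The extra value [ord_max] collects the uniforms outside [0, 1[, an event of probability zero. *)
pose J w : 'I_(size L).+1 := if 0 <= U i w < 1 then inord (K w) else ord_max.
have mI : measurable (`[0, 1[%classic : set R) by exact: measurable_itv.
have mJ : discrete_measurable_fun J.
  apply: (discrete_glue (g := fun (b : bool) w => if b then inord (K w) else ord_max)).
    apply/discrete_bool; apply: measurable_and.
      by apply: measurable_fun_ler => //; exact: measurable_cst.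
    by apply: measurable_fun_ltr => //; exact: measurable_cst.
  case; last exact: discrete_cst.
  exact: (discrete_comp (fun k => inord k) (discrete_sample_index v i)).
have Klt w : 0 <= U i w < 1 -> (K w < size L)%N.
  by case/andP => _; exact: sample_index_lt.
set Ev := [set w | _].
have mEv : measurable Ev by exact: (measurable_loop_event ((x, z, true) :: o :: D) (i :: s)).
rewrite (measure_partition P (measurableI _ _ (measurable_box mA) mEv) mJ).
rewrite big_ord_recr /= [X in (_ + X)%E](_ : _ = 0%E) ?adde0; last first.
  have mIC := measurableC mI.
  apply/eqP; rewrite eq_le measure_ge0 andbT.
  apply: (@le_trans _ _ (P (box (box_update A i (~` `[0, 1[%classic))))).
    apply: le_measure; rewrite ?inE.
    - by do 2 (apply: measurableI => //); exact: measurable_box.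
    - by apply: measurable_box; exact: measurable_box_update.
    - move=> w [[Aw _] /= Jw] j; rewrite /box_update; case: eqP => [->|_]; last exact: Aw.
      rewrite /= in_itv /= => U01; move: Jw; rewrite /J U01 => /(congr1 val) /= /eqP.
      by rewrite inordK ?ltnS ?(ltnW (Klt _ U01)) // (ltn_eqF (Klt _ U01)).
  by rewrite box_update_prob // uniform_prob_setC_unit mule0.
have termE (j : 'I_(size L)) :
    (P (box A `&` Ev `&` [set w | J w = widen_ord (leqnSn _) j]) =
     P (box A) * (v j * loop_mean sel (o :: D) (rem x AR) (rem (tnth (in_tuple L) j) L)
       (fun t => (phi ((tnth (in_tuple L) j, z) :: t))%:R))%:E)%E.
  pose y := tnth (in_tuple L) j.
  have yE : nth origin L j = y by rewrite /y (tnth_nth origin).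
  have yL : y \in L by exact: mem_tnth.
  have c0 : 0 <= cumulative v j by exact: sumr_ge0.
  have cc : cumulative v j <= cumulative v j.+1 by exact: le_cumulative.
  have c1 : cumulative v j.+1 <= 1 by rewrite -(cumulative_max v1) le_cumulative.
  pose B : set R := `[cumulative v j, cumulative v j.+1[%classic.
  have mB : measurable B by exact: measurable_itv.
  (* Drawing [j] means that the current uniform lies in [B], an interval of length [v j]; once this
     is recorded in the box, the rest of the loop falls under the induction hypothesis. *)
  rewrite (_ : _ `&` _ = box (box_update A i B) `&`
      [set w | phi ((y, z) :: transform_loop sel (o :: D) [seq U i w | i <- s]
         (rem x AR) (rem y L))]).
    have sup j' : j' \in s -> box_update A i B j' = setT.
      move=> j's; rewrite /box_update As' //; case: eqP => // j'i.
      by rewrite -j'i j's in iNs.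
    have sr : (size (o :: D) <= size (rem y L))%N by rewrite size_rem // -ltnS prednK.
    rewrite (IHD s _ (measurable_box_update i mA mB) _ _
      (fun t => phi ((y, z) :: t)) us Ds sup ARr sr).
    rewrite box_update_prob // uniform_prob_itvco // -muleA -EFinM.
    by rewrite cumulativeS addrAC subrr add0r.
  apply/seteqP; split => w.
    move=> [[Aw Evw] /= Jw].
    have U01 : 0 <= U i w < 1.
      apply/negPn/negP => U01; move: Jw; rewrite /J (negbTE U01) => /(congr1 val) /= jE.
      by have := ltn_ord j; rewrite -jE ltnn.
    have Kj : K w = j.
      by move: Jw; rewrite /J U01 => /(congr1 val); rewrite /= inordK // ltnS ltnW // Klt.
    have Bw : B (U i w).
      by rewrite /B /= in_itv /= -sample_indexP //; [exact/eqP|case/andP: U01].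
    split.
      by move=> j'; rewrite /box_update; case: eqP => [->|_]; [|exact: Aw].
    by move: Evw; rewrite /Ev /= -/v -yE -Kj.
  move=> [Aw Evw].
  have Bw : B (U i w) by have := Aw i; rewrite /box_update eqxx.
  have /andP[Uj jU] : cumulative v j <= U i w < cumulative v j.+1 by move: Bw; rewrite /B /= in_itv.
  have U01 : 0 <= U i w < 1 by rewrite (le_trans c0 Uj) (lt_le_trans jU c1).
  have Kj : K w = j by apply/eqP; rewrite sample_indexP ?Uj ?jU // (le_trans c0 Uj).
  split; last first.
    by apply: val_inj; rewrite /= /J U01 Kj inordK // ltnS ltnW.
  split; last by rewrite /Ev /= -/v -[sample_from _ _ _]/(nth origin L (K w)) Kj yE.
  move=> j'; have := Aw j'; rewrite /box_update; case: eqP => // -> _.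
  by rewrite Ai.
rewrite (eq_bigr _ (fun j _ => termE j)).
have PE : P (box A) = (fine (P (box A)))%:E.
  by rewrite fineK // fin_num_measure //; exact: measurable_box.
rewrite PE; under eq_bigr do rewrite -EFinM.
by rewrite sumEFin -mulr_sumr.
Qed.

End LoopProbability.

(** * Independence under the null hypothesis *)

Section PairLaws.
Context {R : realType} {d1 d2 : measure_display}.
Context {T1 : measurableType d1} {T2 : measurableType d2}.
Local Open Scope ereal_scope.

Lemma pair_measure_unique (m1 m2 : {measure set (T1 * T2) -> \bar R}) :
  m1 setT < +oo ->
  (forall A B, measurable A -> measurable B -> m1 (A `*` B) = m2 (A `*` B)) ->
  forall S, measurable S -> m1 S = m2 S.
Proof.
move=> m1oo m12 S mS.
pose C : set (set (T1 * T2)) :=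
  [set C | exists A, measurable A /\ exists B, measurable B /\ C = A `*` B].
apply: (measure_unique C (fun=> setT)) => //.
- rewrite measurable_prod_measurableType //; congr (<<s _ >>).
  rewrite predeqE; split => [[A mA [B mB <-]]|[A [mA [B [mB ->]]]]].
    by exists A; split => //; exists B.
  by exists A => //; exists B.
- move=> /= _ _ [X1 [mX1 [X2 [mX2 ->]]]] [Y1 [mY1 [Y2 [mY2 ->]]]].
  rewrite -setXI; exists (X1 `&` Y1); split; first exact: measurableI.
  by exists (X2 `&` Y2); split => //; exact: measurableI.
- by move=> _; exists setT; split => //; exists setT; split => //; rewrite setXTT.
- by rewrite bigcup_const.
- by move=> _ [A [mA [B [mB ->]]]]; exact: m12.
Qed.

End PairLaws.

Section RandomPairs.
Context {dO : measure_display} {Omega : measurableType dO} {R : realType}.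
Variable P : probability Omega R.
Context {d1 d2 : measure_display} {T1 : measurableType d1} {T2 : measurableType d2}.
Local Open Scope ereal_scope.
Implicit Types (V : Omega -> T1) (W : Omega -> T2).

Lemma eq_pair_law V W V' W' : measurable_fun setT V -> measurable_fun setT W ->
  measurable_fun setT V' -> measurable_fun setT W' ->
  (forall A B, measurable A -> measurable B ->
     P (V @^-1` A `&` W @^-1` B) = P (V' @^-1` A `&` W' @^-1` B)) ->
  forall S, measurable S ->
    P ((fun w => (V w, W w)) @^-1` S) = P ((fun w => (V' w, W' w)) @^-1` S).
Proof.
move=> mV mW mV' mW' VW S mS.
pose f : {mfun Omega >-> (T1 * T2)%type} := mfun_Sub (mem_set (measurable_fun_pair mV mW)).
pose f' : {mfun Omega >-> (T1 * T2)%type} := mfun_Sub (mem_set (measurable_fun_pair mV' mW')).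
apply: (pair_measure_unique (m1 := distribution P f) (m2 := distribution P f')) => //.
by apply: le_lt_trans (probability_le1 (distribution P f) measurableT) (ltry _).
Qed.

Lemma indep_event_pair V W (E : set Omega) : measurable_fun setT V ->
  measurable_fun setT W -> measurable E ->
  (forall A B, measurable A -> measurable B ->
     P (V @^-1` A `&` W @^-1` B `&` E) = P (V @^-1` A `&` W @^-1` B) * P E) ->
  forall S, measurable S ->
    P ((fun w => (V w, W w)) @^-1` S `&` E) = P ((fun w => (V w, W w)) @^-1` S) * P E.
Proof.
move=> mV mW mE VW S mS.
pose f : {mfun Omega >-> (T1 * T2)%type} := mfun_Sub (mem_set (measurable_fun_pair mV mW)).
have PE : P E = (fine (P E))%:E by rewrite fineK // fin_num_measure.
pose c : {nonneg R} := NngNum (fine_ge0 (measure_ge0 P E)).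
rewrite muleC PE.
have := pair_measure_unique (m1 := pushforward (mrestr P mE) f)
  (m2 := mscale c (pushforward P f)) _ _ mS; apply.
  change (P (f @^-1` setT `&` E) < +oo); rewrite preimage_setT setTI.
  by apply: le_lt_trans (probability_le1 P mE) (ltry _).
move=> A B mA mB; change (P (V @^-1` A `&` W @^-1` B `&` E) =
  (fine (P E))%:E * P (V @^-1` A `&` W @^-1` B)).
by rewrite -PE muleC VW.
Qed.

End RandomPairs.

(* Since T is independent of X, a version of P(T in A | X) is almost surely
   constant, so conditional independence given X becomes independence. *)
Lemma cond_independent_factor {dS : measure_display} {S : measurableType dS}
    {R : realType} (Q : probability S R) {d1 d2 d3 : measure_display}
    {E : measurableType d1} {E2 : measurableType d2} {E3 : measurableType d3}
    (X : {mfun S >-> E}) (T : {mfun S >-> E2}) (C : {mfun S >-> E3}) :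
  cond_independent Q X T C -> independent_rv Q C X -> independent_rv Q T X ->
  forall A B F, measurable A -> measurable B -> measurable F ->
    Q (T @^-1` A `&` C @^-1` B `&` X @^-1` F) =
    (Q (T @^-1` A) * Q (C @^-1` B) * Q (X @^-1` F))%E.
Proof.
move=> ci CX TX A B F mA mB mF.
have [gT [gC [[mgT gT01 gTE] [mgC gC01 gCE] [mg g01 gE]]]] := ci A B mA mB.
have mpre (d : measure_display) (E' : measurableType d) (Y : {mfun S >-> E'}) D :
    measurable D -> measurable (Y @^-1` D).
  by move=> mD; rewrite -[X in measurable X]setTI; exact: measurable_funPT.
pose muX := distribution Q X.
have QA : Q (T @^-1` A) = (fine (Q (T @^-1` A)))%:E.
  by rewrite fineK // fin_num_measure //; exact: mpre.
set c := fine _ in QA.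
have push (f : E -> R) D : measurable D -> measurable_fun setT f -> (forall x, 0 <= f x) ->
    (\int[Q]_(w in X @^-1` D) (f (X w))%:E = \int[muX]_(x in D) (f x)%:E)%E.
  move=> mD mf f0; rewrite ge0_integral_pushforward //.
    by apply/measurable_EFinP; exact: measurable_funTS.
  by move=> x _; rewrite lee_fin.
(* Over every [D] both functions integrate to the probability that T lies in [A] and X in [D]: for
   the constant this is the independence of T and X. *)
have aec : ae_eq muX setT (fun=> c%:E) (fun x => (gT x)%:E).
  apply: integral_ae_eq => //.
  - exact: finite_measure_integrable_cst.
  - exact/measurable_EFinP.
  - move=> D _ mD; rewrite integral_cst // -push //; last by move=> x; case/andP: (gT01 x).
    by rewrite -gTE // TX // QA.
rewrite gE // (push (fun x => gT x * gC x)) //; last by move=> x; case/andP: (g01 x).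
transitivity (\int[muX]_(x in F) (c%:E * (gC x)%:E))%E.
  apply: ae_eq_integral => //.
  - by apply/measurable_EFinP; exact: measurable_funTS.
  - by apply: emeasurable_funM; [exact: measurable_cst|];
       apply/measurable_EFinP; exact: measurable_funTS.
  - by apply: filterS aec => x h _; rewrite EFinM h.
rewrite ge0_integralZl //.
- rewrite -push //; last by move=> x; case/andP: (gC01 x).
  by rewrite -gCE // CX // QA muleA.
- by apply/measurable_EFinP; exact: measurable_funTS.
- by move=> x _; rewrite lee_fin; case/andP: (gC01 x).
- by rewrite lee_fin fine_ge0.
Qed.

Section ExchangeablePairs.
Context {dO : measure_display} {Omega : measurableType dO} {R : realType}.
Variable P : probability Omega R.
Context {d1 d2 : measure_display} {T1 : measurableType d1} {T2 : measurableType d2}.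
Context {n : nat}.
Variables (V : 'I_n -> Omega -> T1) (W : 'I_n -> Omega -> T2).
Hypothesis mV : forall i, measurable_fun setT (V i).
Hypothesis mW : forall i, measurable_fun setT (W i).
Variables (a : set T1 -> \bar R) (b : set T2 -> \bar R).
Hypothesis a1 : a setT = 1%E.
Hypothesis b1 : b setT = 1%E.
Local Open Scope ereal_scope.
Hypothesis VW_prob : forall (A : 'I_n -> set T1) (B : 'I_n -> set T2),
  (forall i, measurable (A i)) -> (forall i, measurable (B i)) ->
  P [set w | forall i, A i (V i w) /\ B i (W i w)] = \prod_i (a (A i) * b (B i)).

Let tupV (g : 'S_n) w : n.-tuple T1 := [tuple V (g i) w | i < n].
Let tupW w : n.-tuple T2 := [tuple W i w | i < n].

Let mtupV g : measurable_fun setT (tupV g).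
Proof.
apply/measurable_fun_tnthP => i; rewrite (_ : _ \o _ = V (g i)) //.
by apply/funext => w; rewrite /= tnth_mktuple.
Qed.

Let mtupW : measurable_fun setT tupW.
Proof.
apply/measurable_fun_tnthP => i; rewrite (_ : _ \o _ = W i) //.
by apply/funext => w; rewrite /= tnth_mktuple.
Qed.

Let rect_prob g A B : (forall i, measurable (A i)) -> (forall i, measurable (B i)) ->
  P (tupV g @^-1` rectangle A `&` tupW @^-1` rectangle B) =
  \prod_i a (A i) * \prod_i b (B i).
Proof.
move=> mA mB; rewrite (_ : _ `&` _ =
    [set w | forall i, A (g^-1%g i) (V i w) /\ B i (W i w)]).
  rewrite (VW_prob (fun i => mA (g^-1%g i)) mB) big_split /=; congr (_ * _).
  by rewrite [RHS](reindex_inj (@perm_inj _ g^-1%g)).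
apply/seteqP; split => w; rewrite /rectangle /=.
  move=> [hA hB] i; split; last by have := hB i; rewrite tnth_mktuple.
  by have := hA (g^-1%g i); rewrite tnth_mktuple permKV.
move=> h; split => i; rewrite tnth_mktuple; last by case: (h i).
by have [] := h (g i); rewrite permK.
Qed.

Let rectT (T : Type) : rectangle (fun=> setT) = setT :> set (n.-tuple T).
Proof. by apply/seteqP; split. Qed.

Let rectV_prob g A : (forall i, measurable (A i)) ->
  P (tupV g @^-1` rectangle A) = \prod_i a (A i).
Proof.
move=> mA; have := @rect_prob g A (fun=> setT) mA (fun=> measurableT).
by rewrite rectT preimage_setT setIT [X in _ = _ * X]big1 ?mule1.
Qed.

Let rectW_prob B : (forall i, measurable (B i)) ->
  P (tupW @^-1` rectangle B) = \prod_i b (B i).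
Proof.
move=> mB; have := @rect_prob 1%g (fun=> setT) B (fun=> measurableT) mB.
by rewrite rectT preimage_setT setTI [X in _ = X * _]big1 ?mul1e.
Qed.

Let indep_tuples g S1 S2 : measurable S1 -> measurable S2 ->
  P (tupV g @^-1` S1 `&` tupW @^-1` S2) = P (tupV g @^-1` S1) * P (tupW @^-1` S2).
Proof.
move=> mS1 mS2.
have mpV : measurable (tupV g @^-1` S1).
  by rewrite -[X in measurable X]setTI; exact: mtupV.
have mpW B : (forall i, measurable (B i)) -> measurable (tupW @^-1` rectangle B).
  by move=> mB; rewrite -[X in measurable X]setTI; apply: mtupW => //; exact: measurable_rectangle.
rewrite setIC muleC; apply: indep_event_tuple => // B mB.
rewrite setIC muleC; apply: indep_event_tuple => // [|A mA]; first exact: mpW.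
by rewrite rect_prob // rectV_prob // rectW_prob.
Qed.

(** The product over [i] of the [a (A i)] ignores the order of the factors, so [tupV g] has the same
    law for every [g]; the product form also makes it independent of [tupW]. *)
Lemma permuted_pair_law g S : measurable S ->
  P ((fun w => (tupV g w, tupW w)) @^-1` S) =
  P ((fun w => (tupV 1%g w, tupW w)) @^-1` S).
Proof.
move=> mS; apply: eq_pair_law => // A B mA mB.
rewrite !indep_tuples //; congr (_ * _).
by apply: eq_tuple_law => // A' mA'; rewrite !rectV_prob.
Qed.

End ExchangeablePairs.

(** * Measurability of the statistic and of its rank *)

Section RankMeasurable.
Context {dE : measure_display} {E : measurableType dE} {R : realType} {d : nat}.
Notation pt := (d.-tuple R).
Notation obs := (@observation R d).

Lemma measurable_sqrt (f : E -> R) : measurable_fun setT f ->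
  measurable_fun setT (fun e => Num.sqrt (f e)).
Proof.
move=> mf; apply: (measurableT_comp (f := @Num.sqrt R)) mf.
by apply: continuous_measurable_fun; exact: sqrt_continuous.
Qed.

Lemma measurable_enorm (x : E -> pt) : measurable_fun setT x ->
  measurable_fun setT (fun e => enorm (x e)).
Proof.
move=> /measurable_fun_tnthP mx; apply: measurable_sqrt; apply: measurable_sum => i.
by apply: measurable_funX; exact: mx.
Qed.

Lemma measurable_point_dist (x y : E -> pt) : measurable_fun setT x ->
  measurable_fun setT y -> measurable_fun setT (fun e => Defs.edist (x e) (y e)).
Proof.
move=> /measurable_fun_tnthP mx /measurable_fun_tnthP my.
apply: measurable_sqrt; apply: measurable_sum => i; apply: measurable_funX.
by apply: measurable_funB; [exact: mx|exact: my].
Qed.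

Lemma measurable_HSIC n (F : E -> 'I_n -> pt * R) :
  (forall i, measurable_fun setT (fun e => F e i)) ->
  measurable_fun setT (fun e => HSIC (F e)).
Proof.
move=> mF.
have m1 i : measurable_fun setT (fun e => (F e i).1) by exact: measurableT_comp.
have m2 i : measurable_fun setT (fun e => (F e i).2) by exact: measurableT_comp.
have mk i j : measurable_fun setT (fun e => kernel_x (F e i).1 (F e j).1).
  apply: measurable_funB; last exact: measurable_point_dist.
  by apply: measurable_funD; exact: measurable_enorm.
have ml i j : measurable_fun setT (fun e => kernel_y (F e i).2 (F e j).2).
  apply: measurable_funB; last first.
    by apply: measurableT_comp => //; exact: measurable_funB.
  by apply: measurable_funD; apply: measurableT_comp.
apply: measurable_funB; last first.
  apply: measurable_funM; first exact: measurable_cst.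
  by do 3 (apply: measurable_sum => ?); exact: measurable_funM.
apply: measurable_funD; (apply: measurable_funM; first exact: measurable_cst).
  by do 2 (apply: measurable_sum => ?); exact: measurable_funM.
do 2 (apply: measurable_sum => ?); apply: measurable_funM => //.
by do 2 (apply: measurable_sum => ?).
Qed.

Lemma discrete_rank B (h : E -> 'I_B.+1 -> R) tau :
  (forall j, measurable_fun setT (fun e => h e j)) ->
  discrete_measurable_fun (fun e => rank_of_first (h e) tau).
Proof.
move=> mh; rewrite (_ : (fun e => _) = fun e => (count id
    [seq (h e ord0 < h e j) || ((h e j == h e ord0) && (tau j < tau ord0)%N)
      | j <- enum 'I_B.+1]).+1).
  apply: (discrete_comp (fun l => (count id l).+1)); apply: discrete_map => j.
  apply: (discrete_comp2 orb); first by apply/discrete_bool; exact: measurable_fun_ltr.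
  apply: (discrete_comp (fun b => b && _)); apply/discrete_bool.
  exact: measurable_fun_eqr.
apply/funext => e; rewrite /rank_of_first count_map cardE size_filter.
by rewrite -enumT.
Qed.

Variable sel : selection_rule R d.
Hypothesis sel_rule : optimal_selection_rule sel.

Lemma measurable_transform n m (D : E -> n.-tuple obs) (us : E -> m.-tuple R) :
  measurable_fun setT D -> measurable_fun setT us ->
  @measurable_seq _ E _ (pt * R)%type (origin, 0) (fun e => transform sel (D e) (us e)).
Proof.
move=> /measurable_fun_tnthP mD /measurable_fun_tnthP mus.
have mx i : measurable_fun setT (fun e => (tnth (D e) i).1.1).
  by do 2 apply: (measurableT_comp measurable_fst); exact: mD.
have mz i : measurable_fun setT (fun e => (tnth (D e) i).1.2).
  apply: (measurableT_comp measurable_snd); apply: (measurableT_comp measurable_fst).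
  exact: mD.
(* The answers [K] to all pairwise comparisons of times determine the sorting order, which
   [order_of] recovers; there are countably many such patterns. *)
pose pairs := enum {: 'I_n * 'I_n}.
pose K e := [seq (tnth (D e) ij.1).1.2 <= (tnth (D e) ij.2).1.2 | ij <- pairs].
pose order_of (l : seq bool) := sort (fun i j => nth false l (index (i, j) pairs)) (enum 'I_n).
have mK : discrete_measurable_fun K.
  by apply: discrete_map => ij; apply/discrete_bool; exact: measurable_fun_ler.
have sortE e : sort (fun a b : obs => a.1.2 <= b.1.2) (D e) =
    [seq tnth (D e) i | i <- order_of (K e)].
  rewrite -[in LHS](map_tnth_enum (D e)) sort_map; congr map; rewrite /order_of.
  congr sort; apply/funext => i; apply/funext => j; rewrite /K.
  have ijp : (i, j) \in pairs by rewrite mem_enum.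
  by rewrite (nth_map (i, j)) ?index_mem // nth_index.
have usE e : us e = [seq tnth (us e) i | i <- enum 'I_m] :> seq R by rewrite map_tnth_enum.
rewrite (_ : (fun e => _) = fun e => transform_loop sel
    [seq tnth (D e) i | i <- order_of (K e)] [seq tnth (us e) i | i <- enum 'I_m]
    [seq (tnth (D e) i).1.1 | i <- order_of (K e)]
    [seq (tnth (D e) i).1.1 | i <- order_of (K e)]); last first.
  by apply/funext => e; rewrite /transform sortE -usE -map_comp.
apply: (measurable_seq_glue (g := fun l e => transform_loop sel
    [seq tnth (D e) i | i <- order_of l] [seq tnth (us e) i | i <- enum 'I_m]
    [seq (tnth (D e) i).1.1 | i <- order_of l]
    [seq (tnth (D e) i).1.1 | i <- order_of l])) => // l.
have mxs : measurable_seq origin (fun e => [seq (tnth (D e) i).1.1 | i <- order_of l]).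
  exact: (measurable_seq_map _ (order_of l) mx).
pose O := [seq (fun e => tnth (D e) i) | i <- order_of l].
pose us' := [seq (fun e => tnth (us e) i) | i <- enum 'I_m].
rewrite (_ : (fun e => _) = fun e => transform_loop sel [seq o e | o <- O]
    [seq u e | u <- us'] [seq (tnth (D e) i).1.1 | i <- order_of l]
    [seq (tnth (D e) i).1.1 | i <- order_of l]); last first.
  by apply/funext => e; rewrite -[[seq o e | o <- O]]map_comp -[[seq u e | u <- us']]map_comp.
apply: measurable_transform_loop => //.
- by move=> o /List.in_map_iff[i [<- _]]; exact: mD.
- by move=> u /List.in_map_iff[i [<- _]]; exact: mus.
Qed.

Lemma discrete_transform_rank n m B (D : E -> n.-tuple obs) (us : E -> m.-tuple R)
    (pi : 'I_B -> 'S_n) (tau : 'S_B.+1) :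
  measurable_fun setT D -> measurable_fun setT us ->
  discrete_measurable_fun (fun e =>
    rank_of_first (HSIC_values (transform sel (D e) (us e)) pi) tau).
Proof.
move=> mD mus; have [_ mT] := measurable_transform mD mus.
apply: discrete_rank => j; rewrite /HSIC_values; case: unlift => [b|].
  apply: measurable_HSIC => i; rewrite /permute_data /dataset.
  apply: measurable_fun_pair.
    exact: (measurableT_comp measurable_fst (mT _)).
  exact: (measurableT_comp measurable_snd (mT _)).
by apply: measurable_HSIC => i; exact: mT.
Qed.

End RankMeasurable.

(** * The law of the rank *)

Section SectionIntegral.
Context {dO : measure_display} {Omega : measurableType dO} {R : realType}.
Variable P : probability Omega R.
Context {d1 d2 : measure_display} {T1 : measurableType d1} {T2 : measurableType d2}.
Variables (V : Omega -> T1) (W : Omega -> T2) (E : set Omega).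
Hypothesis mV : measurable_fun setT V.
Hypothesis mW : measurable_fun setT W.
Hypothesis mE : measurable E.
Local Open Scope ereal_scope.
Hypothesis VW : forall A B, measurable A -> measurable B ->
  P (V @^-1` A `&` W @^-1` B) = P (V @^-1` A) * P (W @^-1` B).
Hypothesis VWE : forall A B, measurable A -> measurable B ->
  P (V @^-1` A `&` W @^-1` B `&` E) = P (V @^-1` A) * P (W @^-1` B) * P E.

(** The law of the pair is the product of its marginals, so its value on [F] is an integral over
    sections; [E] splits off, being independent of the pair. *)
Lemma independent_section_integral (F : set (T1 * T2)) : measurable F ->
  P ((fun w => (V w, W w)) @^-1` F `&` E) =
  P E * \int[P]_w P (W @^-1` xsection F (V w)).
Proof.
move=> mF.
pose f : {mfun Omega >-> T1} := mfun_Sub (mem_set mV).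
pose g : {mfun Omega >-> T2} := mfun_Sub (mem_set mW).
pose fg : {mfun Omega >-> (T1 * T2)%type} := mfun_Sub (mem_set (measurable_fun_pair mV mW)).
rewrite indep_event_pair //; last by move=> A B mA mB; rewrite VWE // VW.
rewrite muleC; congr (_ * _).
rewrite -[LHS]/(distribution P fg F).
rewrite -(product_measure_unique (m1 := distribution P f) (m2 := distribution P g)
   (m' := distribution P fg)) //.
rewrite /product_measure1 /= ge0_integral_distribution //.
exact: measurable_fun_xsection.
Qed.

Lemma measurable_section_prob (F : set (T1 * T2)) : measurable F ->
  measurable_fun setT (fun x => P (W @^-1` xsection F x)).
Proof.
move=> mF; pose g : {mfun Omega >-> T2} := mfun_Sub (mem_set mW).
exact: (measurable_fun_xsection (distribution P g)) mF.
Qed.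

End SectionIntegral.

(** Used with [x] equal to alpha times B+1, where it turns uniformity of the rank into the level of
    the test. *)
Lemma sum_le_nat_bound {R : realFieldType} (x : R) n : 0 <= x ->
  \sum_(k < n) ((k.+1)%:R <= x)%R%:R <= x.
Proof.
move=> x0; elim: n => [|n IHn]; first by rewrite big_ord0.
rewrite big_ord_recr /=; case: (leP n.+1%:R x) => nx; last by rewrite addr0.
apply: le_trans nx; rewrite -natr1 lerD2r.
apply: (@le_trans _ _ (\sum_(k < n) 1)); last by rewrite sumr_const card_ord.
by apply: ler_sum => k _; rewrite lern1 leq_b1.
Qed.

Section PvalueLaw.
Context {dO : measure_display} {Omega : measurableType dO} {R : realType} {d n B : nat}.
Variable P : probability Omega R.
Variable sel : selection_rule R d.
Hypothesis sel_rule : optimal_selection_rule sel.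
Hypothesis n_gt0 : (0 < n)%N.
Notation obs := (@observation R d).
Variable D : Omega -> n.-tuple obs.
Variable U : 'I_n.-1 -> Omega -> R.
Variables (pis : 'I_B -> Omega -> 'S_n) (tau : Omega -> 'S_B.+1).
Hypothesis mD : measurable_fun setT D.
Hypothesis mU : forall i, measurable_fun setT (U i).
Local Open Scope ereal_scope.
Hypothesis D_exch : forall (g : 'S_n) S, measurable S ->
  P ((fun w => permute_covariates g (D w)) @^-1` S) = P (D @^-1` S).
Hypothesis U_unif : forall i (A : set R), measurable A ->
  P (U i @^-1` A) = uniform_prob (@ltr01 R) A.
Hypothesis pis_unif : forall b, uniform_perm P (pis b).
Hypothesis tau_unif : uniform_perm P tau.
Hypothesis all_indep : mutually_independent P (randomness_sources D U pis tau).

Let Uvec w : n.-1.-tuple R := [tuple U i w | i < n.-1].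

Let mUvec : measurable_fun setT Uvec.
Proof.
apply/measurable_fun_tnthP => i; rewrite (_ : _ \o _ = U i) //.
by apply/funext => w; rewrite /= tnth_mktuple.
Qed.

Let drawn pi t : set Omega := [set w | [ffun b => pis b w] = pi] `&` [set w | tau w = t].

(** The probability of any one outcome of the B permutations and the tie-breaking. *)
Let c : R := ((n`!%:R^-1) ^+ B * (B.+1)`!%:R^-1)%R.

(** The single use of mutual independence: the factorisations below come from setting some sides to
    [setT], then passing from rectangles to general sets of uniforms. *)
Lemma randomness_prob S (A : 'I_n.-1 -> set R) (Spi : 'I_B -> set 'S_n) (St : set 'S_B.+1) :
  measurable S -> (forall i, measurable (A i)) ->
  P (D @^-1` S `&` Uvec @^-1` rectangle A `&`
     ([set w | forall b, Spi b (pis b w)] `&` tau @^-1` St)) =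
  P (D @^-1` S) * (\prod_i uniform_prob (@ltr01 R) (A i)) *
    (\prod_b P (pis b @^-1` Spi b) * P (tau @^-1` St)).
Proof.
move=> mS mA.
pose ev (s : (unit + 'I_n.-1) + ('I_B + unit)) : set Omega :=
  match s with
  | inl (inl _) => D @^-1` S
  | inl (inr i) => U i @^-1` A i
  | inr (inl b) => pis b @^-1` Spi b
  | inr (inr _) => tau @^-1` St
  end.
have := @all_indep ev _.
rewrite !big_sumType /= !(big_pred1 tt) //; try by case.
move=> H; rewrite (_ : _ `&` _ = \bigcap_s ev s).
  rewrite H; last first.
    case=> [[[]|i]|[b|[]]] /=.
    - by exists S => //; rewrite setTI.
    - by exists (A i) => //; rewrite setTI.
    - by exists (Spi b) => //; rewrite setTI.
    - by exists St => //; rewrite setTI.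
  by congr (_ * _ * _); apply: eq_bigr => i _; exact: U_unif.
apply/seteqP; split => w /=.
  move=> [[DS UA] [hpi ht]] [[[]|i]|[b|[]]] _ /=; [exact: DS| |exact: hpi|exact: ht].
  by have := UA i; rewrite tnth_mktuple.
move=> H'; split; split; [exact: (H' (inl (inl tt)) I)| |move=> b|].
- by move=> i; rewrite tnth_mktuple; exact: (H' (inl (inr i)) I).
- exact: (H' (inr (inl b)) I).
- exact: (H' (inr (inr tt)) I).
Qed.

Let drawnE pi t : drawn pi t =
  [set w | forall b, [set pi b] (pis b w)] `&` tau @^-1` [set t].
Proof.
apply/seteqP; split => w /= [hpi ht]; split => //.
  by move=> b; rewrite -hpi ffunE.
by apply/ffunP => b; rewrite ffunE hpi.
Qed.

Let Uvec_rect A : (forall i, measurable (A i)) ->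
  P (Uvec @^-1` rectangle A) = \prod_i uniform_prob (@ltr01 R) (A i).
Proof.
move=> mA; have := randomness_prob (fun=> setT) setT measurableT mA.
rewrite !preimage_setT setTI (_ : [set w | _] = setT) ?setTI ?setIT //.
by rewrite probability_setT [X in _ * (X * _)]big1 ?mul1e ?mule1 // => b _;
  rewrite preimage_setT probability_setT.
by apply/seteqP; split.
Qed.

Let draw_marginals (pi : {ffun 'I_B -> 'S_n}) t :
  \prod_b P (pis b @^-1` [set pi b]) * P (tau @^-1` [set t]) = c%:E.
Proof.
rewrite (eq_bigr (fun=> (n`!%:R^-1)%:E)) => [|b _]; last by have [] := pis_unif b (pi b).
have [_ ->] := tau_unif t.
by rewrite prodEFin prodr_const card_ord -EFinM.
Qed.

Let drawn_prob pi t : P (drawn pi t) = c%:E.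
Proof.
rewrite drawnE.
have := randomness_prob (fun b => [set pi b]) [set t] measurableT
  (A := fun=> setT) (fun=> measurableT).
rewrite (_ : rectangle _ = setT) ?preimage_setT ?setTI; last by apply/seteqP; split.
move=> ->; rewrite probability_setT [X in _ * X * _]big1 ?mul1e // => i _.
by rewrite probability_setT.
Qed.

Let mD_pre S : measurable S -> measurable (D @^-1` S).
Proof. by move=> mS; rewrite -[X in measurable X]setTI; exact: mD. Qed.

Let DU_indep S1 S2 : measurable S1 -> measurable S2 ->
  P (D @^-1` S1 `&` Uvec @^-1` S2) = P (D @^-1` S1) * P (Uvec @^-1` S2).
Proof.
move=> mS1 mS2; rewrite setIC muleC; apply: indep_event_tuple => // [|A mA].
  exact: mD_pre.
rewrite setIC muleC Uvec_rect //.
have := randomness_prob (fun=> setT) setT mS1 mA.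
rewrite !preimage_setT (_ : [set w | _] = setT) ?setIT => [->|]; last first.
  by apply/seteqP; split.
by rewrite probability_setT [X in _ * (X * _)]big1 ?mule1.
Qed.

Let measurable_drawn pi t : measurable (drawn pi t).
Proof.
rewrite drawnE; apply: measurableI; last by have [] := tau_unif t.
rewrite (_ : mkset _ = \bigcap_b (pis b @^-1` [set pi b])).
  by apply: fin_bigcap_measurable => // b _; have [] := pis_unif b (pi b).
by apply/seteqP; split => w h b; [move=> _; exact: h|exact: (h b I)].
Qed.

Let DU_drawn_indep pi t S1 S2 : measurable S1 -> measurable S2 ->
  P (D @^-1` S1 `&` Uvec @^-1` S2 `&` drawn pi t) =
  P (D @^-1` S1) * P (Uvec @^-1` S2) * P (drawn pi t).
Proof.
move=> mS1 mS2.
have mp := measurableI _ _ (mD_pre mS1) (measurable_drawn pi t).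
have P1 : P (D @^-1` S1 `&` drawn pi t) = P (D @^-1` S1) * P (drawn pi t).
  have := randomness_prob (fun b => [set pi b]) [set t] mS1
    (A := fun=> setT) (fun=> measurableT).
  rewrite -drawnE (_ : rectangle _ = setT); last by apply/seteqP; split.
  rewrite preimage_setT setIT => ->; rewrite drawn_prob.
  rewrite [X in _ * X * _]big1 ?mule1 => [|i _]; last by rewrite probability_setT.
  by rewrite draw_marginals.
rewrite -setIA setIC [X in X `&` _]setIC setIC.
rewrite (_ : _ `&` _ = Uvec @^-1` S2 `&` (D @^-1` S1 `&` drawn pi t)); last first.
  by apply/seteqP; split => w /=; tauto.
rewrite [P (D @^-1` S1) * _]muleC -muleA -P1; apply: indep_event_tuple => // A mA.
rewrite P1 drawn_prob Uvec_rect //.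
rewrite (_ : _ `&` _ = D @^-1` S1 `&` Uvec @^-1` rectangle A `&` drawn pi t); last first.
  by apply/seteqP; split => w /=; tauto.
rewrite drawnE (randomness_prob (fun b => [set pi b]) [set t] mS1 mA).
rewrite draw_marginals.
by rewrite muleA; congr (_ * _); rewrite muleC.
Qed.

Definition observed_rank w : nat :=
  rank_of_first (HSIC_values (transform sel (D w) (Uvec w)) (fun b => pis b w)) (tau w).

Let draws w : {ffun 'I_B -> 'S_n} * 'S_B.+1 := ([ffun b => pis b w], tau w).

Let discrete_draws : discrete_measurable_fun draws.
Proof.
move=> [pi t]; rewrite (_ : mkset _ = drawn pi t) //.
by apply/seteqP; split => w; rewrite /drawn /draws /= => -[-> ->].
Qed.

Let observed_rankE w : observed_rank w = rank_of_first
  (HSIC_values (transform sel (D w) (Uvec w)) (draws w).1) (draws w).2.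
Proof.
rewrite /observed_rank; congr (rank_of_first (HSIC_values _ _)).
by apply/funext => b; rewrite ffunE.
Qed.

Lemma discrete_observed_rank : discrete_measurable_fun observed_rank.
Proof.
rewrite (_ : observed_rank = fun w => rank_of_first
  (HSIC_values (transform sel (D w) (Uvec w)) (draws w).1) (draws w).2).
  apply: (discrete_glue (J := draws) (g := fun j w => rank_of_first
    (HSIC_values (transform sel (D w) (Uvec w)) j.1) j.2)) => // j.
  exact: discrete_transform_rank.
by apply/funext => w; exact: observed_rankE.
Qed.

Let event k (j : {ffun 'I_B -> 'S_n} * 'S_B.+1) : set (n.-tuple obs * n.-1.-tuple R) :=
  [set e : n.-tuple obs * n.-1.-tuple R |
    rank_of_first (HSIC_values (transform sel e.1 e.2) j.1) j.2 = k].

Let measurable_event k j : measurable (event k j).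
Proof.
exact: (@discrete_transform_rank _ _ R d sel sel_rule n n.-1 B fst snd j.1 j.2
  measurable_fst measurable_snd k).
Qed.

Let mean k (j : {ffun 'I_B -> 'S_n} * 'S_B.+1) (x : n.-tuple obs) : R :=
  transform_mean sel x (fun s => (rank_of_first (HSIC_values s j.1) j.2 == k)%:R).

(** With the data frozen at [x] only the uniforms are random, and the law of the loop applies with
    an unconstrained box. *)
Let section_prob k j x : P (Uvec @^-1` xsection (event k j) x) = (mean k j x)%:E.
Proof.
pose A (i : 'I_n.-1) : set R := setT.
have boxE A' : box (fun i => U i : Omega -> R) A' = Uvec @^-1` rectangle A'.
  apply/seteqP; split => w h i; first by rewrite tnth_mktuple; exact: h.
  by have := h i; rewrite tnth_mktuple.
have bp A' : (forall i, measurable (A' i)) -> P (box U A') = \prod_i uniform_prob (@ltr01 R) (A' i).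
  by move=> mA'; rewrite boxE Uvec_rect.
pose D' := sort (@time_le R d) x; pose xs := [seq o.1.1 | o <- D'].
have sD' : size D' = n by rewrite size_sort size_tuple.
have s1 : (size D' <= (size (enum 'I_n.-1)).+1)%N by rewrite sD' size_enum_ord prednK.
have s2 : (size D' <= size xs)%N by rewrite size_map.
have := loop_event_prob sel_rule mU bp (A := A) (L := xs)
  (fun s => rank_of_first (HSIC_values s j.1) j.2 == k) (enum_uniq _) s1
  (fun=> measurableT) (fun _ _ => erefl) erefl s2.
rewrite (_ : box U A = setT); last by apply/seteqP; split.
rewrite setTI probability_setT mul1e => H.
rewrite /mean /transform_mean -H.
congr (P _); apply/seteqP; split => w /=.
  by rewrite /xsection /= inE => /eqP.
by move=> /eqP h; rewrite /xsection /= inE.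
Qed.

Let mean_ge0 k j x : (0 <= mean k j x)%R.
Proof. by rewrite -lee_fin -section_prob. Qed.

Let measurable_mean k j : measurable_fun setT (mean k j).
Proof.
apply/measurable_EFinP.
rewrite (_ : _ \o _ = fun x => P (Uvec @^-1` xsection (event k j) x)).
  exact: measurable_section_prob.
by apply/funext => x; rewrite section_prob.
Qed.

Let rank_drawn_prob k j : P ([set w | observed_rank w = k] `&` [set w | draws w = j]) =
  c%:E * \int[P]_w (mean k j (D w))%:E.
Proof.
case: j => pi t; rewrite -(drawn_prob pi t).
under eq_integral do rewrite -section_prob.
rewrite -(independent_section_integral mD mUvec (measurable_drawn pi t) DU_indep
  (@DU_drawn_indep pi t) (measurable_event k (pi, t))).
congr (P _); apply/seteqP; split => w /=.
  by move=> [+ dw]; rewrite observed_rankE dw => h; split => //; case: dw.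
move=> [h [h1 h2]]; have dw : draws w = (pi, t) by rewrite /draws h1 h2.
by split => //; rewrite observed_rankE dw.
Qed.

(** Multiplied by [c], the probability of rank [k] when the data are frozen at [x]. *)
Let total k x : R := (\sum_j mean k j x)%R.

Let measurable_total k : measurable_fun setT (total k).
Proof. exact: measurable_sum. Qed.

Let total_ge0 k x : (0 <= total k x)%R.
Proof. exact: sumr_ge0. Qed.

Let measurable_permute g : measurable_fun setT (fun x : n.-tuple obs => permute_covariates g x).
Proof.
apply/measurable_fun_tnthP => i.
rewrite (_ : _ \o _ = fun x : n.-tuple obs =>
  ((tnth x (g i)).1.1, (tnth x i).1.2, (tnth x i).2)); last first.
  by apply/funext => x; rewrite /= tnth_mktuple.
have mt l : measurable_fun setT (fun x : n.-tuple obs => tnth x l) by exact: measurable_tnth.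
apply: measurable_fun_pair; last exact: (measurableT_comp measurable_snd).
apply: measurable_fun_pair.
  by do 2 apply: (measurableT_comp measurable_fst).
by apply: (measurableT_comp measurable_snd); apply: (measurableT_comp measurable_fst).
Qed.

Let total_permute k g :
  \int[P]_w (total k (permute_covariates g (D w)))%:E = \int[P]_w (total k (D w))%:E.
Proof.
have mDg : measurable_fun setT (fun w => permute_covariates g (D w)).
  exact: (measurableT_comp (measurable_permute g)).
pose f : {mfun Omega >-> n.-tuple obs} := mfun_Sub (mem_set mD).
pose fg : {mfun Omega >-> n.-tuple obs} := mfun_Sub (mem_set mDg).
have mt : measurable_fun setT (fun x => (total k x)%:E) by exact/measurable_EFinP.
transitivity (\int[distribution P fg]_x (total k x)%:E).
  by rewrite ge0_integral_distribution // => x; rewrite lee_fin.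
transitivity (\int[distribution P f]_x (total k x)%:E); last first.
  by rewrite ge0_integral_distribution // => x; rewrite lee_fin.
by apply: eq_measure_integral => S mS _; exact: D_exch.
Qed.

(** Symmetrisation: by exchangeability, n! copies of the integral equal the integral of the sum of
    [total] over all permuted datasets, and that sum is a constant by [sum_transform_mean]. *)
Let integral_total k : (1 <= k <= B.+1)%N ->
  \int[P]_w (total k (D w))%:E = ((n`!%:R ^+ B * (B.+1)`!%:R) / B.+1%:R)%:E.
Proof.
move=> kB.
have n0 : (n`!%:R != 0 :> R)%R by rewrite pnatr_eq0 -lt0n fact_gt0.
have : (n`!%:R)%:E * \int[P]_w (total k (D w))%:E =
    ((n`! ^ B.+1 * (B.+1)`!)%:R / B.+1%:R)%:E.
  transitivity (\sum_(g : 'S_n) \int[P]_w (total k (permute_covariates g (D w)))%:E).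
    rewrite (eq_bigr _ (fun g _ => total_permute k g)).
    transitivity (\sum_(g : 'S_n) 1%:E * \int[P]_w (total k (D w))%:E).
      by rewrite -ge0_sume_distrl // sumEFin sumr_const card_Sn.
    by apply: eq_bigr => g _; rewrite mul1e.
  rewrite -ge0_integral_sum //; last 2 first.
  - move=> g; apply/measurable_EFinP.
    apply: (measurableT_comp (measurable_total k)).
    exact: (measurableT_comp (measurable_permute g) mD).
  - by move=> g w _; rewrite lee_fin.
  transitivity (\int[P]_w (cst ((n`! ^ B.+1 * (B.+1)`!)%:R / B.+1%:R)%:E w)).
    apply: eq_integral => w _; rewrite sumEFin; congr (_%:E).
    have b0 : (B.+1%:R != 0 :> R)%R by rewrite pnatr_eq0.
    apply: (mulIf b0); rewrite divfK // -(sum_transform_mean sel_rule (D w) n_gt0 kB).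
    congr (_ * _)%R; apply: eq_bigr => g _; rewrite pair_bigA /=.
    by apply: eq_bigr => j _.
  by rewrite integral_cst //= probability_setT mule1.
move=> H; rewrite -[LHS]mul1e -[X in X%:E * _](mulVf n0) EFinM -muleA H -EFinM.
congr (_%:E); rewrite natrM natrX exprS.
by rewrite !mulrA mulVf // mul1r.
Qed.

Lemma observed_rank_uniform k : (1 <= k <= B.+1)%N ->
  P [set w | observed_rank w = k] = (B.+1%:R^-1)%:E.
Proof.
move=> kB.
rewrite (measure_partition P (discrete_observed_rank k) discrete_draws).
rewrite (eq_bigr _ (fun j _ => rank_drawn_prob k j)).
rewrite -ge0_sume_distrr; last by move=> j _; apply: integral_ge0 => w _; rewrite lee_fin.
rewrite -ge0_integral_sum //; last 2 first.
- move=> j; apply/measurable_EFinP.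
  exact: (measurableT_comp (measurable_mean k j) mD).
- by move=> j w _; rewrite lee_fin.
under eq_integral do rewrite sumEFin.
rewrite integral_total // -EFinM; congr (_%:E); rewrite /c.
have n0 : (n`!%:R != 0 :> R)%R by rewrite pnatr_eq0 -lt0n fact_gt0.
have b0 : ((B.+1)`!%:R != 0 :> R)%R by rewrite pnatr_eq0 -lt0n fact_gt0.
by rewrite exprVn -invfM mulrA mulVf ?mul1r // mulf_neq0 // expf_neq0.
Qed.

End PvalueLaw.

(** Supplies the product form needed for exchangeability: within one triple the observed time and
    the censoring indicator are functions of (T, C), which is independent of X. *)
Lemma censored_sample_prob {R : realType} {d n : nat} {dS : measure_display}
    {S : measurableType dS} (Q : probability S R)
    (X : {RV Q >-> d.-tuple R}) (T C : {RV Q >-> R})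
    {dO : measure_display} {Omega : measurableType dO} (P : probability Omega R)
    (Xs : 'I_n -> {RV P >-> d.-tuple R}) (Ts Cs : 'I_n -> {RV P >-> R}) :
  cond_independent Q X T C -> independent_rv Q C X -> independent_rv Q T X ->
  (forall i (A : set (d.-tuple R * R * R)), measurable A ->
     P ((fun w => (Xs i w, Ts i w, Cs i w)) @^-1` A) =
     Q ((fun w => (X w, T w, C w)) @^-1` A)) ->
  mutually_independent P
     (fun i : 'I_n => sigma_of (fun w => (Xs i w, Ts i w, Cs i w))) ->
  forall (A : 'I_n -> set (d.-tuple R)) (B : 'I_n -> set (R * bool)),
  (forall i, measurable (A i)) -> (forall i, measurable (B i)) ->
  P [set w | forall i, A i (Xs i w) /\
    B i (Num.min (Ts i w) (Cs i w), Ts i w < Cs i w)] =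
  (\prod_i (Q (X @^-1` A i) *
    Q ((fun w => (Num.min (T w) (C w), (T w < C w)%R)) @^-1` B i)))%E.
Proof.
move=> ci CX TX copies indep A B mA mB.
pose G i : set (d.-tuple R * R * R) :=
  [set u | A i u.1.1 /\ B i (Num.min u.1.2 u.2, u.1.2 < u.2)].
have mpre (d1 d2 : measure_display) (E1 : measurableType d1) (E2 : measurableType d2)
    (f : E1 -> E2) F : measurable_fun setT f -> measurable F -> measurable (f @^-1` F).
  by move=> mf mF; rewrite -[X in measurable X]setTI; exact: mf.
have mYcoord (d1 : measure_display) (E1 : measurableType d1) (t c : E1 -> R) :
    measurable_fun setT t -> measurable_fun setT c ->
    measurable_fun setT (fun e => (Num.min (t e) (c e), t e < c e)).
  move=> mt mc; apply: measurable_fun_pair; first exact: measurable_minr.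
  exact: measurable_fun_ltr.
have mG i : measurable (G i).
  apply: measurableI.
    apply: (mpre _ _ _ _ (fun u : d.-tuple R * R * R => u.1.1)) => //.
    exact: (measurableT_comp measurable_fst measurable_fst).
  apply: (mpre _ _ _ _ (fun u : d.-tuple R * R * R => (Num.min u.1.2 u.2, u.1.2 < u.2))) => //.
  apply: mYcoord => //.
  exact: (measurableT_comp measurable_snd measurable_fst).
rewrite (_ : mkset _ = \bigcap_i ((fun w => (Xs i w, Ts i w, Cs i w)) @^-1` G i)); last first.
  by apply/seteqP; split => w h i; [move=> _; exact: h|exact: (h i I)].
rewrite indep; last by move=> i; exists (G i) => //; rewrite setTI.
apply: eq_bigr => i _; rewrite copies //.
have mTC : measurable_fun setT (fun w => (T w, C w)) by exact: measurable_fun_pair.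
pose F : set (R * R) := (fun u => (Num.min u.1 u.2, u.1 < u.2)) @^-1` B i.
have mF : measurable F by apply: mpre => //; apply: mYcoord.
have mX : measurable (X @^-1` A i) by exact: mpre.
have TCX := cond_independent_factor ci CX TX.
have TC A' B' : measurable A' -> measurable B' ->
    Q (T @^-1` A' `&` C @^-1` B') = (Q (T @^-1` A') * Q (C @^-1` B'))%E.
  move=> mA' mB'; have := TCX A' B' setT mA' mB' measurableT.
  by rewrite preimage_setT setIT probability_setT mule1.
rewrite muleC.
(* The factorisation known for product events in (T, C) is extended to [F], which need not be a
   product since the indicator compares T with C. *)
have := @indep_event_pair _ _ _ Q _ _ _ _ T C (X @^-1` A i) _ _ mX _ F mF.
rewrite (_ : _ `&` _ = (fun w => (X w, T w, C w)) @^-1` G i); last first.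
  by apply/seteqP; split => w /=; [case|case].
by apply=> // A' B' mA' mB'; rewrite TCX // TC.
Qed.

Theorem theorem5p1 (R : realType) (d n B : nat) (alpha : R)
  (n_gt0 : (0 < n)%N) (B_ge1 : (1 <= B)%N) (alpha01 : 0 <= alpha <= 1)
  (* the population triple (X, T, C) *)
  (dS : measure_display) (S : measurableType dS) (Q : probability S R)
  (X : {RV Q >-> d.-tuple R}) (T C : {RV Q >-> R})
  (T_ge0 : forall w, 0 <= T w) (C_ge0 : forall w, 0 <= C w)
  (T_density : has_cond_density Q X T)
  (TC_cond_indep : cond_independent Q X T C)
  (CX_indep : independent_rv Q C X)
  (* the i.i.d. copies (X_i, T_i, C_i) *)
  (dO : measure_display) (Omega : measurableType dO) (P : probability Omega R)
  (Xs : 'I_n -> {RV P >-> d.-tuple R}) (Ts Cs : 'I_n -> {RV P >-> R})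
  (Ts_ge0 : forall i w, 0 <= Ts i w) (Cs_ge0 : forall i w, 0 <= Cs i w)
  (copies : forall i (A : set (d.-tuple R * R * R)), measurable A ->
     P ((fun w => (Xs i w, Ts i w, Cs i w)) @^-1` A) =
     Q ((fun w => (X w, T w, C w)) @^-1` A))
  (copies_indep : mutually_independent P
     (fun i : 'I_n => sigma_of (fun w => (Xs i w, Ts i w, Cs i w))))
  (* the observed right-censored data (X_i, Z_i, Delta_i) *)
  (D : Omega -> n.-tuple (d.-tuple R * R * bool))
  (D_def : forall w, D w =
     [tuple (Xs i w, Num.min (Ts i w) (Cs i w), Ts i w < Cs i w) | i < n])
  (Z_distinct :
     {ae P, forall w, injective (fun i => Num.min (Ts i w) (Cs i w))})
  (* the rule selecting an optimal coupling *)
  (sel : selection_rule R d) (sel_rule : optimal_selection_rule sel)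
  (* the internal randomness *)
  (U : 'I_n.-1 -> {RV P >-> R})
  (U_unif : forall i (A : set R), measurable A ->
     P (U i @^-1` A) = uniform_prob (@ltr01 R) A)
  (pis : 'I_B -> Omega -> 'S_n) (pis_unif : forall b, uniform_perm P (pis b))
  (tau : Omega -> 'S_B.+1) (tau_unif : uniform_perm P tau)
  (all_indep : mutually_independent P
     (randomness_sources D (fun i => U i : Omega -> R) pis tau))
  (* the p-value of the optHSIC test *)
  (p : Omega -> R)
  (p_def : forall w, p w =
     optHSIC_pvalue sel (D w) [seq U i w | i <- enum 'I_n.-1]
       (fun b => pis b w) (tau w))
  (H0 : independent_rv Q T X) :
  [/\ measurable_fun setT p,
      forall k : nat, (1 <= k <= B.+1)%N ->
        P [set w | p w = k%:R / B.+1%:R] = (B.+1%:R^-1)%:E &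
      (P [set w | (p w <= alpha)%R] <= alpha%:E)%E].
Proof.
have mTr (i : 'I_n) : measurable_fun setT (Ts i) by exact: measurable_funPT.
pose Y (i : 'I_n) w : R * bool := (Num.min (Ts i w) (Cs i w), Ts i w < Cs i w).
have mY i : measurable_fun setT (Y i).
  by apply: measurable_fun_pair; [exact: measurable_minr|exact: measurable_fun_ltr].
(* The data are rebuilt from the tuple of covariates and the tuple of times with indicators.
   Permuting covariates touches only the former, so the invariance of the pair of tuples carries
   over to [D]. *)
pose zipD (xy : n.-tuple (d.-tuple R) * n.-tuple (R * bool)) :
    n.-tuple (d.-tuple R * R * bool) :=
  [tuple (tnth xy.1 i, (tnth xy.2 i).1, (tnth xy.2 i).2) | i < n].
have mzip : measurable_fun setT zipD.
  apply/measurable_fun_tnthP => i.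
  rewrite (_ : _ \o _ = fun xy : n.-tuple (d.-tuple R) * n.-tuple (R * bool) =>
    (tnth xy.1 i, (tnth xy.2 i).1, (tnth xy.2 i).2)); last first.
    by apply/funext => xy; rewrite /= tnth_mktuple.
  have m1 : measurable_fun setT
      (fun xy : n.-tuple (d.-tuple R) * n.-tuple (R * bool) => tnth xy.1 i).
    exact: (measurableT_comp (measurable_tnth i) measurable_fst).
  have m2 : measurable_fun setT
      (fun xy : n.-tuple (d.-tuple R) * n.-tuple (R * bool) => tnth xy.2 i).
    exact: (measurableT_comp (measurable_tnth i) measurable_snd).
  apply: measurable_fun_pair; last exact: (measurableT_comp measurable_snd m2).
  apply: measurable_fun_pair => //; exact: (measurableT_comp measurable_fst m2).
pose XY g w := ([tuple Xs ((g : 'S_n) i) w | i < n], [tuple Y i w | i < n]).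
have DgE g w : permute_covariates g (D w) = zipD (XY g w).
  apply: eq_from_tnth => i; by rewrite D_def !tnth_mktuple /= ?tnth_mktuple.
have DE w : D w = zipD (XY 1%g w).
  rewrite -DgE; apply: eq_from_tnth => i; by rewrite D_def !tnth_mktuple perm1.
have mD : measurable_fun setT D.
  rewrite (_ : D = zipD \o XY 1%g); last by apply/funext => w; rewrite DE.
  apply: (measurableT_comp mzip); apply: measurable_fun_pair; apply/measurable_fun_tnthP => i.
    rewrite (_ : _ \o _ = Xs ((1%g : 'S_n) i)) //.
    by apply/funext => w; rewrite /= tnth_mktuple.
  rewrite (_ : _ \o _ = Y i) //; by apply/funext => w; rewrite /= tnth_mktuple.
have D_exch (g : 'S_n) A : measurable A ->
    P ((fun w => permute_covariates g (D w)) @^-1` A) = P (D @^-1` A).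
  move=> mA.
  have mzA : measurable (zipD @^-1` A) by rewrite -[X in measurable X]setTI; exact: mzip.
  have H := censored_sample_prob TC_cond_indep CX_indep H0 copies copies_indep.
  have := @permuted_pair_law _ _ _ P _ _ _ _ n (fun i => Xs i : Omega -> _) Y
    (fun i => measurable_funPT (Xs i)) mY
    (fun A => Q (X @^-1` A)) (fun B => Q ((fun w => (Num.min (T w) (C w), T w < C w)) @^-1` B))
    _ _ H g _ mzA.
  rewrite !preimage_setT !probability_setT => /(_ erefl erefl).
  rewrite (_ : (fun w => permute_covariates g (D w)) @^-1` A = XY g @^-1` (zipD @^-1` A)).
    rewrite (_ : D @^-1` A = XY 1%g @^-1` (zipD @^-1` A)) //.
    by apply/seteqP; split => w /=; rewrite DE.
  by apply/seteqP; split => w /=; rewrite DgE.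
have mU i : measurable_fun setT (U i) by exact: measurable_funPT.
pose rank := observed_rank sel D (fun i => U i : Omega -> R) pis tau.
have pE w : p w = (rank w)%:R / B.+1%:R.
  by rewrite p_def /optHSIC_pvalue.
have drank : discrete_measurable_fun rank by exact: discrete_observed_rank.
have urank := observed_rank_uniform sel_rule n_gt0 mD mU D_exch U_unif pis_unif tau_unif all_indep.
have b0 : B.+1%:R != 0 :> R by rewrite pnatr_eq0.
have mp : measurable_fun setT p.
  rewrite (_ : p = fun w => (rank w)%:R / B.+1%:R); last by apply/funext => w; rewrite pE.
  exact: (@measurable_fun_glue _ _ nat _ R rank (fun k _ => k%:R / B.+1%:R) drank
    (fun k => measurable_cst _)).
split => //.
  move=> k kB; rewrite -(urank k kB); congr (P _); apply/seteqP; split => w /=.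
    by rewrite pE => /(mulIf (invr_neq0 b0))/eqP; rewrite eqr_nat => /eqP.
  by rewrite pE /rank => ->.
case/andP: alpha01 => a0 a1.
have rank_gt0 w : (0 < rank w)%N by [].
have rank_le w : (rank w <= B.+1)%N by exact: rank_at_le.
(* Ranks run from 1 to B+1; the value 0 of the ordinal is never taken and its term is peeled off
   below. *)
pose J w : 'I_B.+2 := inord (rank w).
have JE w : J w = rank w :> nat by rewrite inordK // ltnS rank_le.
have dJ : discrete_measurable_fun J by apply: (discrete_comp (fun k => inord k)).
have mpa : measurable [set w | p w <= alpha].
  have := measurable_fun_ler mp (@measurable_cst _ _ Omega R setT alpha).
  by move=> /discrete_bool /(_ true).
rewrite (measure_partition P mpa dJ) big_ord_recl /=.
rewrite [X in (X + _)%E](_ : _ = 0%E) ?add0e; last first.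
  rewrite (_ : _ `&` _ = set0) ?measure0 //; apply/seteqP; split => w //= [_ Jw].
  by have := rank_gt0 w; rewrite -JE Jw.
(* On the event that the rank is [j.+1], rejection is certain or impossible according to whether
   [j.+1] is at most alpha times B+1. *)
rewrite (eq_bigr (fun j : 'I_B.+1 =>
    ((((j.+1)%:R <= alpha * B.+1%:R)%R)%:R / B.+1%:R)%:E)) => [|j _]; last first.
  case: (leP j.+1%:R (alpha * B.+1%:R)) => ja.
    have jB : (1 <= j.+1 <= B.+1)%N by exact: ltn_ord.
    rewrite mul1r -(urank _ jB); congr (P _); apply/seteqP; split => w /=.
      by move=> [_ Jw]; rewrite -[LHS]JE Jw.
    move=> rw; split; first by rewrite pE /rank rw ler_pdivrMr ?ltr0n.
    by apply: val_inj; rewrite /= JE.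
  rewrite mul0r (_ : _ `&` _ = set0) ?measure0 //; apply/seteqP; split => w //= [pa Jw].
  move: pa; rewrite pE ler_pdivrMr ?ltr0n // -JE Jw /= /bump /= add1n.
  by rewrite leNgt ja.
rewrite sumEFin lee_fin -mulr_suml ler_pdivrMr ?ltr0n //.
by apply: sum_le_nat_bound; rewrite mulr_ge0.
Qed.
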